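(* Let $K$ be a field of characteristic $p=2$, let $\mathcal L=\mathrm{Lie}(v_1,v_2)$ be the Fibonacci Lie algebra over $K$ and $W$ its basis of standard monomials. Let $\lambda=(1+\sqrt5)/2$. Let $u=w_1\wedge\cdots\wedge w_n\in\Lambda^n(\mathcal L)=C_n(\mathcal L)$, where $w_i\in W$ are pairwise distinct (or consider a nonzero homogeneous $u\in H_n(\mathcal L)$), $n\ge1$. Then: 1. The weight functions extend naturally to the spaces of chains and to homology groups by $\mathrm{Wt}(u):=\mathrm{Wt}\,w_1+\cdots+\mathrm{Wt}\,w_n\in\mathbb R^2$. 2. The multidegree extends naturally by $\mathrm{Gr}(u):=\mathrm{Gr}\,w_1+\cdots+\mathrm{Gr}\,w_n\in\mathbb Z^2$. 3. The chain spaces and homology groups are $\mathbb Z^2$-graded, e.g. $H_n(\mathcal L)=\bigoplus_{(a,b)\in\mathbb Z^2}H_{n,(a,b)}(\mathcal L)$, $n\ge1$, where $H_{n,(a,b)}(\mathcal L)$ is spanned by the elements of $H_n(\mathcal L)$ of multidegree $(a,b)$. 4. Assume that $\{w_1,\dots,w_n\}\subset W_{\le m}$ and at least one $w_i$ belongs to $W_m$, where $m\ge1$. Then $\lambda^{m-1}<\mathrm{wt}\,u\le n\lambda^m$. 5. Let $\mathrm{Gr}(u)=(x,y)\in\mathbb Z^2$. The respective points for $H_n(\mathcal L)$ (or $C_n(\mathcal L)$) belong to the strip given in terms of the superweight or the multidegree coordinates by $$-\lambda n<\mathrm{swt}\,u<n;\qquad -\lambda^3n+\lambda x<y<\lambda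 x+\lambda^2n.$$ 6. $\mathrm{GKdim}\,H_n(\mathcal L)\le n\log_\lambda2$, where the growth is defined via the $\mathbb N$-grading. 7. $\displaystyle\sum_{n=2}^\infty\dim H_n(\mathcal L)=\infty$.
   Context: $R=K[t_i\mid i\ge 0]/(t_i^2\mid i\ge 0)$, $\partial_i=\partial/\partial t_i\in\mathrm{Der}\,R$. The pivot elements are the derivations $v_i=\partial_i+t_{i-1}(\partial_{i+1}+t_i(\partial_{i+2}+t_{i+1}(\partial_{i+3}+\cdots)))$, $i\ge1$, so $v_i=\partial_i+t_{i-1}v_{i+1}$. $\mathcal L$ is the Lie subalgebra of $\mathrm{Der}\,R$ generated by $v_1,v_2$. It has the basis $W=\bigcup_{n\ge1}W_n$, $W_n=\{t_0^{\alpha_0}\cdots t_{n-4}^{\alpha_{n-4}}v_n\mid\alpha_i\in\{0,1\}\}$ (so $W_i=\{v_i\}$ for $i\le3$); $W_{\le m}=\bigcup_{i=1}^mW_i$. With $\bar\lambda=(1-\sqrt5)/2$, weight and superweight are additive functions on monomials with $\mathrm{wt}\,v_n=\lambda^n$, $\mathrm{wt}\,t_i=-\lambda^i$, $\mathrm{swt}\,v_n=\bar\lambda^n$, $\mathrm{swt}\,t_i=-\bar\lambda^i$; $\mathrm{Wt}=(\mathrm{wt},\mathrm{swt})$, and for $u$ as in item 1 $\mathrm{Wt}(u)=(\mathrm{wt}\,u,\mathrm{swt}\,u)$. $\mathcal L=\bigoplus_{a,b\ge0}\mathcal L_{a,b}$ is $\mathbb Z^2$-graded, $\mathcal L_{a,b}$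 being spanned by commutators with $a$ factors $v_1$ and $b$ factors $v_2$; elements of $W$ are homogeneous, and $\mathrm{Gr}(w)=(a,b)$ for $0\ne w\in\mathcal L_{a,b}$. One has $\mathrm{wt}\,w=a\lambda+b\lambda^2$, $\mathrm{swt}\,w=-a/\lambda+b/\lambda^2$. $H_n(\mathcal L)$ is the homology with trivial coefficients of the Chevalley–Eilenberg complex $C_n(\mathcal L)=\Lambda^n(\mathcal L)$. That the weight functions and multidegree extend to homology means that the gradings they define on chains are preserved by the differentials, so that homology is graded and a nonzero homogeneous class gets the value of a homogeneous cycle representing it. The $\mathbb N$-grading is by total degree $a+b$, and $\mathrm{GKdim}\,H_n(\mathcal L)=\limsup_{k\to\infty}\frac{\ln\left(\sum_{a+b\le k}\dim H_{n,(a,b)}(\mathcal L)\right)}{\ln k}$. *)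

(* Defs.v *)
From HB Require Import structures.
From mathcomp Require Import all_boot all_order all_algebra.
From mathcomp Require Import finmap.
From mathcomp Require Import all_classical all_reals all_analysis.
From mathcomp Require Import freeg.

Set Implicit Arguments.
Unset Strict Implicit.
Unset Printing Implicit Defensive.

Import Order.TTheory GRing.Theory Num.Theory.

Local Open Scope classical_set_scope.
Local Open Scope ring_scope.

HB.instance Definition _ (K : fieldType) (T : choiceType) (V : lmodType K)
  (f : T -> V) := GRing.isZmodMorphism.Build {freeg T / K} V (fglift f)
    (lift_is_additive f).

Lemma fglift_scalable (K : fieldType) (T : choiceType) (V : lmodType K)
  (f : T -> V) : scalable (fglift f).
Proof.
move=> a x; rewrite -[in LHS](freeg_sumE x) -[in RHS](freeg_sumE x).
rewrite scaler_sumr !raddf_sum.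
apply: eq_bigr => z _.
have -> : a *: << coeff z x *g z >> = << a * coeff z x *g z >>.
  by apply/eqP/freeg_eqP => t; rewrite coeffZ !coeffU mulrA.
by rewrite /= !liftU scalerA.
Qed.

HB.instance Definition _ (K : fieldType) (T : choiceType) (V : lmodType K)
  (f : T -> V) := GRing.isScalable.Build K {freeg T / K} V _ (fglift f)
    (fglift_scalable f).

Section LinearAlgebra.
Variable K : fieldType.

Definition subspace (V : lmodType K) (A : set V) : Prop :=
  A 0 /\ forall a x y, A x -> A y -> A (a *: x + y).

Definition lspan (V : lmodType K) (A : set V) : set V :=
  smallest (@subspace V) A.

Definition lspan_pred (V : lmodType K) (A : set V) : {pred V} :=
  [pred x | x \in lspan A].

Lemma lspanP (V : lmodType K) (A : set V) x :
  reflect (lspan A x) (x \in lspan_pred A).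
Proof. by apply: (iffP idP) => [/set_mem|/mem_set]. Qed.

Lemma lspan_pred_submod (V : lmodType K) (A : set V) :
  submod_closed (lspan_pred A).
Proof.
split=> [|a x y /lspanP Sx /lspanP Sy]; apply/lspanP; first by move=> B [[]].
by move=> B BP; have [[_ +] _] := BP; apply; [exact: Sx|exact: Sy].
Qed.

HB.instance Definition _ (V : lmodType K) (A : set V) :=
  GRing.isSubmodClosed.Build K V (lspan_pred A) (lspan_pred_submod A).

(* The quotient of V by the subspace generated by A. *)
Definition quo (V : lmodType K) (A : set V) : Type :=
  Quotient.quot (lspan_pred A).

HB.instance Definition _ (V : lmodType K) (A : set V) :=
  GRing.Zmodule.on (quo A).

Section Quo.
Variables (V : lmodType K) (A : set V).

Local Notation Q := (Quotient.quot (lspan_pred A)).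

Definition cl (x : V) : quo A := \pi_Q%qT x.

(* A representative of a class: a map out of V that is constant on the classes
   of quo A induces on quo A its composition with rep. *)
Definition rep (x : quo A) : V := generic_quotient.repr (x : Q).

Lemma repK : cancel rep cl.
Proof. by move=> x; rewrite /cl /rep reprK. Qed.

Lemma clE x y : (cl x = cl y) <-> lspan A (x - y).
Proof.
split=> [/eqP|/lspanP h].
  by rewrite -(Quotient.idealrBE (lspan_pred A)) => /lspanP.
by apply/eqP; rewrite -(Quotient.idealrBE (lspan_pred A)).
Qed.

Lemma cl_is_zmod_morphism : zmod_morphism cl.
Proof. by move=> x y; rewrite /cl raddfB. Qed.

Definition quo_scale (a : K) (x : quo A) : quo A := cl (a *: rep x).

Lemma cl_scale a x : quo_scale a (cl x) = cl (a *: x).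
Proof.
apply/clE; rewrite -scalerBr; have /clE h : cl (rep (cl x)) = cl x by rewrite repK.
by apply/lspanP/rpredZ/lspanP.
Qed.

Lemma quo_scalerA a b x : quo_scale a (quo_scale b x) = quo_scale (a * b) x.
Proof. by rewrite -[x]repK !cl_scale scalerA. Qed.

Lemma quo_scale1r : left_id 1 quo_scale.
Proof. by move=> x; rewrite -[x]repK cl_scale scale1r. Qed.

Lemma quo_scalerDr : right_distributive quo_scale +%R.
Proof.
move=> a x y; rewrite -[x]repK -[y]repK !cl_scale.
have clD u v : cl u + cl v = cl (u + v).
  by rewrite /cl raddfD.
by rewrite !clD cl_scale scalerDr.
Qed.

Lemma quo_scalerDl x : {morph quo_scale^~ x : a b / a + b}.
Proof.
by move=> a b; rewrite -[x]repK !cl_scale scalerDl /cl raddfD.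
Qed.

HB.instance Definition _ := GRing.Zmodule_isLmodule.Build K (quo A)
  quo_scalerA quo_scale1r quo_scalerDr quo_scalerDl.

HB.instance Definition _ := GRing.isZmodMorphism.Build V (quo A) cl
  cl_is_zmod_morphism.

HB.instance Definition _ := GRing.isScalable.Build K V (quo A) *:%R cl
  (fun a x => esym (cl_scale a x)).

End Quo.

End LinearAlgebra.

Section FreegExtra.
Variables (K : fieldType) (T : choiceType).

Lemma fgliftE (V : lmodType K) (f : T -> V) (x : {freeg T / K}) :
  fglift f x = \sum_(z <- dom x) coeff z x *: f z.
Proof.
rewrite -[in LHS](freeg_sumE x) raddf_sum /=.
by apply: eq_bigr => z _; rewrite liftU.
Qed.

Lemma fgU1 (k : K) (z : T) :
  << k *g z >> = k *: << 1 *g z >> :> {freeg T / K}.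
Proof. by apply/eqP/freeg_eqP => u; rewrite coeffZ !coeffU mul1r. Qed.

Lemma freeg_lin_ind (P : {freeg T / K} -> Prop) :
  P 0 -> (forall a x y, P x -> P y -> P (a *: x + y)) ->
  (forall z, P << 1 *g z >>) -> forall x, P x.
Proof.
move=> P0 PD P1 x; rewrite -(freeg_sumE x).
elim: (dom x) => [|z s IHs]; first by rewrite big_nil.
by rewrite big_cons fgU1; apply: PD.
Qed.

End FreegExtra.

(* K[t_i | i >= 0] / (t_i^2 | i >= 0), realized on the free K-module whose
   basis consists of the square-free monomials t_A = \prod_(i in A) t_i, for A
   a finite set of indices; t_A * t_B is t_(A u B) if A and B are disjoint and
   0 otherwise. *)
Definition trunc (K : fieldType) : Type := {freeg {fset nat} / K}.

HB.instance Definition _ (K : fieldType) := Choice.on (trunc K).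
HB.instance Definition _ (K : fieldType) := GRing.Lmodule.on (trunc K).

Section Trunc.
Variable K : fieldType.

Definition tmon (A : {fset nat}) : trunc K := << 1 *g A >>.

Lemma trunc_ind (P : trunc K -> Prop) :
  P 0 -> (forall a x y, P x -> P y -> P (a *: x + y)) ->
  (forall A, P (tmon A)) -> forall x, P x.
Proof. exact: freeg_lin_ind. Qed.

Definition tmon_mul (A B : {fset nat}) : trunc K :=
  if [disjoint A & B]%fset then tmon (A `|` B)%fset else 0.

Definition tmul (f g : trunc K) : trunc K :=
  fglift (fun A => fglift (tmon_mul A) g) f.

Lemma tmul_lin_l g : linear (tmul^~ g).
Proof. by move=> a x y; rewrite /tmul linearP. Qed.

Lemma tmulC : commutative tmul.
Proof.
move=> f g; rewrite /tmul !fgliftE.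
under eq_bigr do rewrite fgliftE scaler_sumr.
under [RHS]eq_bigr do rewrite fgliftE scaler_sumr.
rewrite exchange_big; apply: eq_bigr => B _; apply: eq_bigr => A _.
by rewrite !scalerA mulrC /tmon_mul fdisjoint_sym fsetUC.
Qed.

Lemma tmul_lin_r f : linear (tmul f).
Proof. by move=> a x y; rewrite ![tmul f _]tmulC tmul_lin_l. Qed.

Lemma tmulUU A B : tmul (tmon A) (tmon B) = tmon_mul A B.
Proof. by rewrite /tmul /tmon !liftU !scale1r. Qed.

Lemma tmul0f f : tmul 0 f = 0.
Proof. by rewrite /tmul raddf0. Qed.

Lemma tmulA : associative tmul.
Proof.
move=> f g h; move: f; apply: trunc_ind => [|a x y Hx Hy|A].
- by rewrite !tmul0f.
- by rewrite !tmul_lin_l Hx Hy.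
move: g; apply: trunc_ind => [|a x y Hx Hy|B].
- by rewrite tmul0f ![tmul (tmon A) _]tmulC !tmul0f.
- by rewrite !(tmul_lin_l, tmul_lin_r) Hx Hy.
move: h; apply: trunc_ind => [|a x y Hx Hy|C].
- by rewrite ![tmul _ 0]tmulC tmul0f tmulC !tmul0f.
- by rewrite !tmul_lin_r Hx Hy.
rewrite !tmulUU /tmon_mul.
have [dBC|dBC] := boolP [disjoint B & C]%fset; last first.
  rewrite tmulC tmul0f; case: ifP => dAB; last by rewrite tmul0f.
  by rewrite tmulUU /tmon_mul fdisjointUX (negbTE dBC) andbF.
rewrite tmulUU /tmon_mul fdisjointXU; case: (boolP [disjoint A & B]%fset) => dAB /=.
  by rewrite tmulUU /tmon_mul fdisjointUX dBC andbT fsetUA.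
by rewrite tmul0f.
Qed.

Lemma tmul1 : left_id (tmon fset0) tmul.
Proof.
apply: trunc_ind => [|a x y Hx Hy|A].
- by rewrite tmulC tmul0f.
- by rewrite tmul_lin_r Hx Hy.
by rewrite tmulUU /tmon_mul fdisjoint0X fset0U.
Qed.

Lemma tmulDl : left_distributive tmul +%R.
Proof. by move=> f g h; rewrite /tmul raddfD. Qed.

Lemma tmon_neq0 A : tmon A != 0.
Proof. by rewrite /tmon freegU_eq0 oner_eq0. Qed.

HB.instance Definition _ := GRing.Zmodule_isComNzRing.Build (trunc K)
  tmulA tmulC tmul1 tmulDl (tmon_neq0 fset0).

Lemma tscalerAl (a : K) (f g : trunc K) : a *: (f * g) = (a *: f) * g.
Proof. by rewrite /GRing.mul /= /tmul linearZ. Qed.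

HB.instance Definition _ :=
  GRing.Lmodule_isLalgebra.Build K (trunc K) tscalerAl.
HB.instance Definition _ := GRing.Lalgebra_isComAlgebra.Build K (trunc K).

Definition tvar (i : nat) : trunc K := tmon [fset i]%fset.

Lemma tvar_sqr i : tvar i ^+ 2 = 0.
Proof.
rewrite expr2 [LHS]tmulUU /tmon_mul ifF //.
by apply/negbTE; rewrite fdisjointX1 negbK in_fset1.
Qed.

Lemma tmonE (A : {fset nat}) : tmon A = \prod_(i <- A) tvar i.
Proof.
elim/fset1U_rect: A => [|i A iA IH]; first by rewrite big_seq_fset0.
rewrite big_fsetU1 //= -IH [RHS]tmulUU /tmon_mul ifT //.
by rewrite fdisjoint1X.
Qed.

Definition partial (i : nat) : trunc K -> trunc K :=
  fglift (fun A : {fset nat} => if i \in A then tmon (A `\ i)%fset else 0).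

(* The sum \sum_(j >= n) t_(n-1) t_n ... t_(j-2) d/dt_j, where only the indices
   j in A contribute on t_A; see pivot_rec for the recursive description. *)
Definition pivot (n : nat) : trunc K -> trunc K :=
  fglift (fun A : {fset nat} => \sum_(j <- A | (n <= j)%N)
            (\prod_(n.-1 <= k < j.-1) tvar k) * partial j (tmon A)).

Lemma partialU i A : partial i (tmon A) = if i \in A then tmon (A `\ i)%fset else 0.
Proof. by rewrite /partial /tmon liftU scale1r. Qed.

Lemma pivotU n A : pivot n (tmon A) = \sum_(j <- A | (n <= j)%N)
            (\prod_(n.-1 <= k < j.-1) tvar k) * partial j (tmon A).
Proof. by rewrite /pivot [X in fglift _ X]/tmon liftU scale1r. Qed.

Lemma pivot_rec n f : (0 < n)%N -> pivot n f = partial n f + tvar n.-1 * pivot n.+1 f.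
Proof.
case: n => // n _; move: f; apply: trunc_ind => [|a x y Hx Hy|A].
- by rewrite /pivot /partial !raddf0 mulr0 addr0.
- have vL m : pivot m (a *: x + y) = a *: pivot m x + pivot m y by rewrite /pivot linearP.
  rewrite !vL {vL} Hx Hy.
  have -> : partial n.+1 (a *: x + y) = a *: partial n.+1 x + partial n.+1 y.
    by rewrite /partial linearP.
  by rewrite mulrDr scalerDr scalerAr addrACA.
rewrite !pivotU mulr_sumr /=.
have E : \sum_(j <- A | (n.+2 <= j)%N)
    tvar n * (\prod_(n.+1 <= k < j.-1) tvar k * partial j (tmon A)) =
  \sum_(j <- A | (n.+1 <= j)%N && (j != n.+1))
    (\prod_(n <= k < j.-1) tvar k) * partial j (tmon A).
  apply: eq_big => [j|j hj]; first by rewrite ltn_neqAle eq_sym andbC.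
  by rewrite mulrA -big_ltn //; case: j hj.
rewrite E (bigID (fun j => j == n.+1)) /=; congr (_ + _).
rewrite (eq_bigl (pred1 n.+1)) => [|j /=]; last first.
  by case: eqP => [->|_]; rewrite ?leqnn ?andbF.
rewrite -big_filter; have [nA|nA] := boolP (n.+1 \in A).
  have -> : [seq j <- A | pred1 n.+1 j] = [:: n.+1].
    by apply: filter_pred1_uniq => //; exact: fset_uniq.
  by rewrite big_seq1 big_geq // mul1r.
rewrite partialU (negbTE nA) big_filter big_seq_cond big_pred0 // => j.
by apply/negP => /andP[jA /eqP jn]; rewrite -jn jA in nA.
Qed.

End Trunc.

Section FibLie.
Variable K : fieldType.

Local Notation R := (trunc K).

Definition commutator (D E : R -> R) : R -> R := fun f => D (E f) - E (D f).

Definition lie_subalgebra (A : set (R -> R)) : Prop :=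
  subspace A /\ forall D E, A D -> A E -> A (commutator D E).

Definition fib_set : set (R -> R) :=
  smallest lie_subalgebra [set pivot 1; pivot 2].

Definition fib_pred : {pred R -> R} := [pred D | D \in fib_set].

Lemma fibP D : reflect (fib_set D) (D \in fib_pred).
Proof. by apply: (iffP idP) => [/set_mem|/mem_set]. Qed.

Lemma fib_submod : submod_closed fib_pred.
Proof.
split=> [|a x y /fibP Sx /fibP Sy]; apply/fibP; first by move=> B [[[]]].
move=> B BP; have [[[_ +] _] _] := BP.
by apply; [exact: Sx | exact: Sy].
Qed.

HB.instance Definition _ := GRing.isSubmodClosed.Build K (R -> R) fib_pred
  fib_submod.

(* The Lie algebra Lie(v_1, v_2), whose bracket is fib_br. In characteristic 2
   the v_n are derivations of R, and Der R is closed under commutators, so this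
   is the Lie subalgebra of Der R generated by v_1 and v_2. *)
Record fib : Type := Fib { fib_val : R -> R; _ : fib_val \in fib_pred }.

HB.instance Definition _ := [isSub for fib_val].
HB.instance Definition _ := [Choice of fib by <:].
HB.instance Definition _ := [SubChoice_isSubLmodule of fib by <:].

Lemma commutator_fib (x y : fib) : commutator (val x) (val y) \in fib_pred.
Proof.
apply/fibP => B BP; have [[_ +] _] := BP.
by apply; [exact: (fibP _ (valP x)) | exact: (fibP _ (valP y))].
Qed.

Definition fib_br (x y : fib) : fib := Fib (commutator_fib x y).

(* Commutators with a factors v_1 and b factors v_2, and their span L_(a,b). *)
Inductive commutator_of : nat -> nat -> (R -> R) -> Prop :=
| CommPivot1 : commutator_of 1 0 (pivot 1)
| CommPivot2 : commutator_of 0 1 (pivot 2)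
| CommBr a b c d D E : commutator_of a b D -> commutator_of c d E ->
    commutator_of (a + c) (b + d) (commutator D E).

Definition fib_comp (a b : nat) : set (R -> R) :=
  lspan [set D | commutator_of a b D].

End FibLie.

(* Indices of the standard monomials: existT _ k al stands for the monomial
   t_0^(al 0) ... t_(n-4)^(al (n-4)) v_n of level n = k + 1. *)
Definition stdmon : Type := {k : nat & {ffun 'I_(k.+1 - 3) -> bool}}.

Definition lev (w : stdmon) : nat := (tag w).+1.

Definition reaches_level (n m : nat) (w : 'I_n -> stdmon) : Prop :=
  (forall i, (lev (w i) <= m)%N) /\ exists i, lev (w i) = m.

Definition stdmon_der (K : fieldType) (w : stdmon) : trunc K -> trunc K :=
  fun f => (\prod_(i < lev w - 3) tvar K i ^+ tagged w i) * pivot (lev w) f.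

Arguments stdmon_der K w f : clear implicits.

(* All standard monomials lie in fib K, so the default value 0 is not used. *)
Definition stdmon_fib (K : fieldType) (w : stdmon) : fib K :=
  insubd (0 : fib K) (stdmon_der K w).

Arguments stdmon_fib K w : clear implicits.

Definition Gr (K : fieldType) (w : stdmon) : int * int :=
  xget 0 [set g | exists a b : nat,
                    g = (a%:Z, b%:Z) /\ fib_comp a b (stdmon_der K w)].

Arguments Gr K w : clear implicits.

Section Weights.
Variable RR : realType.

Definition lam : RR := (1 + Num.sqrt 5%:R) / 2%:R.
Definition lambar : RR := (1 - Num.sqrt 5%:R) / 2%:R.

Definition weight (l : RR) (w : stdmon) : RR :=
  l ^+ lev w - \sum_(i < lev w - 3) (tagged w i)%:R * l ^+ i.

(* (wt, swt) *)
Definition Wt (w : stdmon) : RR * RR := (weight lam w, weight lambar w).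

End Weights.

Arguments Wt RR w : clear implicits.

Section Dim.
Variables (K : fieldType) (RR : realType).

Definition lin_indep (V : lmodType K) (k : nat) (x : 'I_k -> V) : Prop :=
  forall c : 'I_k -> K, \sum_i c i *: x i = 0 -> forall i, c i = 0.

(* Dimension of the subspace A: the largest size of a linearly independent
   family in A, or +oo if these sizes are unbounded. *)
Definition kdim (V : lmodType K) (A : set V) : \bar RR :=
  ereal_sup [set (k%:R)%:E | k in
    [set k | exists x : 'I_k -> V, (forall i, A (x i)) /\ lin_indep x]].

(* U is the internal direct sum of the subspaces S g. *)
Definition direct_sum (V : lmodType K) (G : eqType) (U : set V)
    (S : G -> set V) : Prop :=
  [/\ forall g, subspace (S g) /\ S g `<=` U,
      forall x, U x -> exists (r : seq G) (f : G -> V),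
        (forall g, S g (f g)) /\ x = \sum_(g <- r) f g
    & forall (r : seq G) (f : G -> V), uniq r -> (forall g, S g (f g)) ->
        \sum_(g <- r) f g = 0 -> forall g, g \in r -> f g = 0].

End Dim.

Section ChevalleyEilenberg.
Variables (K : fieldType) (L : lmodType K) (br : L -> L -> L).

Local Notation tensors n := {freeg {ffun 'I_n -> L} / K}.

Definition ext_rel (n : nat) : set (tensors n) :=
  [set r | exists (i : 'I_n) (a : K) (x y z : {ffun 'I_n -> L}),
      [/\ z i = a *: x i + y i,
          forall k, k != i -> x k = z k /\ y k = z k
        & r = << 1 *g z >> - a *: << 1 *g x >> - << 1 *g y >>]] `|`
  [set r | exists (i j : 'I_n) (x : {ffun 'I_n -> L}),
      [/\ i != j, x i = x j & r = << 1 *g x >>]].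

(* The n-th exterior power of L: multilinear alternating n-fold symbols. *)
Definition chain (n : nat) : lmodType K := quo (@ext_rel n).

Definition wedge (n : nat) (x : 'I_n -> L) : chain n :=
  cl (@ext_rel n) << 1 *g [ffun i => x i] >>.

(* d (x_1 ^ ... ^ x_n) = \sum_(i < j) (-1)^(i + j) [x_i, x_j] ^ x_1 ^ ... with
   x_i and x_j omitted; it is the zero map if n <= 1. The indices i, j start at 0
   here, which does not change the parity of i + j. *)
Definition diff_sym (n : nat) (x : {ffun 'I_n -> L}) : chain n.-1 :=
  \sum_(i < n) \sum_(j < n | (i < j)%N) (-1) ^+ (i + j) *:
    wedge (fun k : 'I_n.-1 =>
      nth 0 (br (x i) (x j) ::
             [seq x l | l <- enum 'I_n & (l != i) && (l != j)]) k).

(* If br is a Lie bracket, diff_sym is multilinear and alternating, so that diff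
   does not depend on the representative. *)
Definition diff (n : nat) (u : chain n) : chain n.-1 :=
  fglift (@diff_sym n) (rep u).

Arguments diff n u : clear implicits.

Definition cycles (n : nat) : set (chain n) := [set z | diff n z = 0].

Definition boundaries (n : nat) : set (chain n) :=
  range (diff n.+1 : chain n.+1 -> chain n).

Arguments cycles n _ : clear implicits.
Arguments boundaries n _ : clear implicits.

(* Homology classes live in chain n / boundaries n. *)
Definition hspace (n : nat) : lmodType K := quo (boundaries n).

Definition hclass (n : nat) (z : chain n) : hspace n := cl (boundaries n) z.

Definition homology (n : nat) : set (hspace n) := @hclass n @` cycles n.

Arguments homology n _ : clear implicits.

Section Grading.
Variables (W : Type) (e : W -> L) (G : nmodType) (f : W -> G).

Definition wedge_of (n : nat) (w : 'I_n -> W) : chain n :=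
  wedge (fun i => e (w i)).

Definition chain_comp (n : nat) (g : G) : set (chain n) :=
  lspan [set wedge_of w | w in
           [set w : 'I_n -> W | injective w /\ \sum_i f (w i) = g]].

Arguments chain_comp n g _ : clear implicits.

Definition hom_comp (n : nat) (g : G) : set (hspace n) :=
  @hclass n @` (cycles n `&` chain_comp n g).

Arguments hom_comp n g _ : clear implicits.

Definition chain_deg (n : nat) (u : chain n) : G :=
  xget 0 [set g | chain_comp n g u].

Definition hom_deg (n : nat) (h : hspace n) : G :=
  xget 0 [set g | hom_comp n g h].

Definition diff_homogeneous (n : nat) : Prop :=
  forall g (u : chain n), chain_comp n g u -> chain_comp n.-1 g (diff n u).

(* f extends to n-chains and to the n-th homology by the rule
   e w_1 ^ ... ^ e w_n |-> f w_1 + ... + f w_n. *)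
Definition degree_extends (n : nat) : Prop :=
  [/\ forall w : 'I_n -> W, injective w ->
        wedge_of w <> 0 /\ chain_deg (wedge_of w) = \sum_i f (w i),
      forall g (u : chain n), u <> 0 -> chain_comp n g u -> chain_deg u = g,
      diff_homogeneous n /\ diff_homogeneous n.+1
    & forall g (z : chain n), cycles n z -> chain_comp n g z ->
        hclass z <> 0 -> hom_deg (hclass z) = g].

Definition graded (n : nat) : Prop :=
  [/\ direct_sum setT (chain_comp n),
      diff_homogeneous n /\ diff_homogeneous n.+1
    & direct_sum (homology n) (hom_comp n)].

End Grading.

End ChevalleyEilenberg.

Arguments chain {K} L n.
Arguments wedge_of {K L W} e {n} w.
Arguments chain_comp {K L W} e {G} f n g _.
Arguments chain_deg {K L W} e {G} f {n} u.
Arguments cycles {K L} br n _.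
Arguments homology {K L} br n _.
Arguments hclass {K L} br {n} z.
Arguments hom_comp {K L} br {W} e {G} f n g _.
Arguments hom_deg {K L} br {W} e {G} f {n} h.
Arguments degree_extends {K L} br {W} e {G} f n.
Arguments graded {K L} br {W} e {G} f n.

(* The extended logarithm lne has lne +oo = +oo and lne 0 = -oo. *)
Definition GKdim_homology (RR : realType) (K : fieldType) (n : nat) : \bar RR :=
  limn_esup (fun k : nat =>
    lne (\esum_(g in [set g : int * int | (g.1 + g.2 <= k%:Z)%R])
           kdim RR (hom_comp (@fib_br K) (stdmon_fib K) (Gr K) n g))
    * ((ln k%:R)^-1)%R%:E)%E.

(* Main.v *)
(* For n < m one has [v_n, v_m] = t_(n-1) ... t_(m-3) v_(m+1); hence the standard
   monomials span a subalgebra, and each of them is a single commutator of v_1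
   and v_2, which gives the multidegree. In characteristic 2 the exterior algebra
   of L embeds in the algebra of square-free polynomials with one variable per
   standard monomial. This yields bases of the chain spaces and projections onto
   their homogeneous components that commute with the differential, hence the
   gradings. The inequalities are bounds on geometric sums of powers of lambda
   and of its conjugate, and the growth of homology is at most that of the number
   of n-tuples of standard monomials.

   For the infinite total dimension, put eps = lambar^(4N). As swt < 1, the set
   A of the monomials w with swt w >= eps wt w is finite, and it contains v_2,
   v_4, ..., v_(2N). No other finite set of monomials has the same total weight
   as A, so the wedge of A spans the component of this weight in the whole chain
   complex and represents a nonzero class in degree #|A| >= N. *)

Require Import Defs.
From HB Require Import structures.
From mathcomp Require Import all_boot all_order all_algebra.
From mathcomp Require Import perm finmap.
From mathcomp Require Import all_classical all_reals all_analysis.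
From mathcomp Require Import freeg ring lra zify.

Set Implicit Arguments.
Unset Strict Implicit.
Unset Printing Implicit Defensive.

Import Order.TTheory GRing.Theory Num.Theory.

Local Open Scope classical_set_scope.
Local Open Scope ring_scope.

(* The topological [subspace] of MathComp-Analysis hides the linear one. *)
Local Notation subspace := Defs.subspace.

(** * Linear spans *)

Section Span.
Variable K : fieldType.
Implicit Types V U : lmodType K.

(** The obstacle is that chains are classes of formal symbols: no basis is available, and [diff] is
    computed on an arbitrary representative. The embedding [theta] settles both. It has [proj predT]
    as a left inverse, so it is injective, and the claim that the differential is multilinear and
    alternating becomes an identity between products in a commutative ring, where the order of
    factors and the signs disappear and contributions cancel in pairs. The gradings are proved for
    any function f from the basis to a commutative monoid such that the bracket of e w and e w'
    expands in basis vectors of degree f w + f w'. Multidegree and the pair of weights are two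
    instances, the latter being a linear function of the former because lambda and its conjugate
    both satisfy x^2 = x + 1. In the last item, A collects the monomials on which swt - eps wt is
    nonnegative, so it maximizes this functional among finite sets. Since lambda lambar = -1 and 4N
    is even, eps = lambda^(-4N); as swt v_(2j) = lambda^(-2j), the element v_(2j) lies in A exactly
    when j <= N. *)

Lemma linear_fun0 V U (f : V -> U) : linear f -> f 0 = 0.
Proof.
by move=> lf; have := lf (-1) 0 0; rewrite scaler0 addr0 scaleN1r addNr.
Qed.

Lemma linear_funD V U (f : V -> U) : linear f -> {morph f : x y / x + y}.
Proof. by move=> lf x y; have := lf 1 x y; rewrite !scale1r. Qed.

Lemma subspaceD V (A : set V) x y : subspace A -> A x -> A y -> A (x + y).
Proof. by move=> [_ h] Ax Ay; rewrite -[x]scale1r; exact: h. Qed.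

Lemma subspaceZ V (A : set V) a x : subspace A -> A x -> A (a *: x).
Proof. by move=> [A0 h] Ax; rewrite -[_ *: _]addr0; exact: h. Qed.

Lemma subspace_sum V (A : set V) (I : Type) (r : seq I) (P : pred I) (F : I -> V) :
  subspace A -> (forall i, P i -> A (F i)) -> A (\sum_(i <- r | P i) F i).
Proof.
move=> sA h; elim/big_rec: _ => [|i x Pi Ax]; first exact: proj1 sA.
by apply: subspaceD => //; exact: h.
Qed.

Lemma subspace_sum_seq V (A : set V) (I : eqType) (r : seq I) (P : pred I)
    (F : I -> V) : subspace A -> (forall i, i \in r -> P i -> A (F i)) ->
  A (\sum_(i <- r | P i) F i).
Proof.
move=> sA h; rewrite big_seq_cond; apply: subspace_sum => // i /andP[ir Pi]; exact: h.
Qed.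

Lemma lspan_subspace V (A : set V) : subspace (lspan A).
Proof.
split=> [B [[]]//|a x y Sx Sy B BP].
by apply: (proj2 (proj1 BP)); [exact: Sx|exact: Sy].
Qed.

Lemma lspan_gen V (A : set V) x : A x -> lspan A x.
Proof. by move=> Ax B [_]; exact. Qed.

Lemma lspan_min V (A B : set V) x : subspace B -> A `<=` B -> lspan A x -> B x.
Proof. by move=> sB AB; apply; split. Qed.

Lemma lspan_mono V (A B : set V) x : A `<=` B -> lspan A x -> lspan B x.
Proof.
move=> AB; apply: lspan_min; first exact: lspan_subspace.
by move=> y /AB; exact: lspan_gen.
Qed.

Lemma subspace_preimage V U (f : V -> U) (B : set U) :
  linear f -> subspace B -> subspace (f @^-1` B).
Proof.
move=> lf sB; split=> [|a x y /= Bx By].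
  by rewrite /preimage /= (linear_fun0 lf); exact: proj1 sB.
by rewrite /preimage /= lf; apply: (proj2 sB).
Qed.

Lemma lspan_linear V U (f : V -> U) (A : set V) (B : set U) x :
  linear f -> subspace B -> (forall y, A y -> B (f y)) -> lspan A x -> B (f x).
Proof.
by move=> lf sB h; apply: (lspan_min (subspace_preimage lf sB)).
Qed.

Lemma subspace0 V : subspace [set 0 : V].
Proof. by split=> // a x y -> -> /=; rewrite scaler0 addr0. Qed.

Lemma lspan_eq_linear V U (f g : V -> U) (A : set V) x :
  linear f -> linear g -> (forall y, A y -> f y = g y) -> lspan A x -> f x = g x.
Proof.
move=> lf lg h Ax; apply/subr0_eq.
suff : [set 0] (f x - g x) by [].
apply: (@lspan_linear V U (fun x => f x - g x) A _ x) => //; last first.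
- by move=> y /h /= ->; rewrite subrr.
- exact: subspace0.
by move=> a u v; rewrite lf lg scalerBr opprD addrACA.
Qed.

End Span.

(** * The derivations v_n *)

(** The recursion [pivot_rec] expresses v_n by v_(n+1) and never ends by itself. On a fixed t_A the
    start of the induction is supplied by all n beyond the indices in A, where v_n kills t_A. *)
Lemma nat_down_ind (P : nat -> Prop) (N n : nat) :
  (forall m, (N <= m)%N -> P m) -> (forall m, (n <= m)%N -> P m.+1 -> P m) ->
  P n.
Proof.
move=> P0 PS; have [nN|/ltnW] := leqP n N; last exact: P0.
rewrite -(subKn nN); move: (leqnn (N - n)).
elim: {1 3}(N - n)%N => [|k IH kN]; first by rewrite subn0 => _; exact: P0.
apply: PS; first by lia.
by rewrite subnSK; [apply: IH; exact: ltnW|lia].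
Qed.

Lemma fset_nat_bound (A : {fset nat}) : exists N, forall j, j \in A -> (j < N)%N.
Proof.
exists (\max_(j <- A) j).+1 => j jA; rewrite ltnS.
by rewrite (big_rem j) //= leq_maxl.
Qed.

Section Derivations.
Variable K : fieldType.
Hypothesis char2 : 2%N \in [pchar K].
Local Notation R := (trunc K).
Implicit Types (A B : {fset nat}) (f g : R).

Lemma trunc_pchar2 : 2%N \in [pchar R].
Proof.
by rewrite inE /= -[X in X == 0](@scaler_nat K) (pcharf0 char2) scale0r.
Qed.

Lemma trunc_addrr f : f + f = 0.
Proof. exact: (addrr_pchar2 trunc_pchar2). Qed.

Lemma partial_linear i : linear (@partial K i).
Proof. exact: linearP. Qed.

Lemma pivot_linear n : linear (@pivot K n).
Proof. exact: linearP. Qed.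

Lemma tmonM A B : tmon K A * tmon K B =
  if [disjoint A & B]%fset then tmon K (A `|` B)%fset else 0.
Proof. exact: tmulUU. Qed.

Lemma trunc_bilin_eq (F G : R -> R -> R) :
  (forall g, linear (F^~ g)) -> (forall f, linear (F f)) ->
  (forall g, linear (G^~ g)) -> (forall f, linear (G f)) ->
  (forall A B, F (tmon K A) (tmon K B) = G (tmon K A) (tmon K B)) ->
  forall f g, F f g = G f g.
Proof.
move=> F1 F2 G1 G2 FG f g; elim/trunc_ind: f => [|a x y Hx Hy|A].
- by rewrite (linear_fun0 (F1 g)) (linear_fun0 (G1 g)).
- by rewrite (F1 g) (G1 g) Hx Hy.
elim/trunc_ind: g => [|a x y Hx Hy|//].
- by rewrite (linear_fun0 (F2 _)) (linear_fun0 (G2 _)).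
- by rewrite F2 G2 Hx Hy.
Qed.

Lemma trunc_lin_eq (F G : R -> R) : linear F -> linear G ->
  (forall A, F (tmon K A) = G (tmon K A)) -> F =1 G.
Proof.
move=> lF lG FG f; elim/trunc_ind: f => [|a x y Hx Hy|//].
- by rewrite (linear_fun0 lF) (linear_fun0 lG).
- by rewrite lF lG Hx Hy.
Qed.

Definition is_deriv (D : R -> R) := forall f g, D (f * g) = D f * g + f * D g.

Lemma deriv_of_tmon (D : R -> R) : linear D ->
  (forall A B, D (tmon K A * tmon K B) =
     D (tmon K A) * tmon K B + tmon K A * D (tmon K B)) -> is_deriv D.
Proof.
move=> lD; apply: trunc_bilin_eq => [g|f|g|f] a x y.
- by rewrite mulrDl -scalerAl lD.
- by rewrite mulrDr -scalerAr lD.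
- by rewrite lD !mulrDl -!scalerAl scalerDr addrACA.
- by rewrite lD !mulrDr -!scalerAr scalerDr addrACA.
Qed.

Lemma partial_deriv i : is_deriv (@partial K i).
Proof.
apply: deriv_of_tmon; first exact: partial_linear.
move=> A B; rewrite tmonM !partialU.
have DA C : (C `\ i)%fset = (C `\` [fset i])%fset by [].
case: ifPn => dAB.
  rewrite partialU in_fsetU; have [iA|iA] := boolP (i \in A).
    have iB : i \notin B by apply: (fdisjointP dAB).
    rewrite (negbTE iB) mulr0 addr0 tmonM ifT; last first.
      by apply: fdisjointWl dAB; exact: fsubD1set.
    by rewrite fsetDUl (mem_fsetD1 iB).
  have [iB|iB] /= := boolP (i \in B); last by rewrite mul0r mulr0 addr0.
  rewrite mul0r add0r tmonM ifT.
    by rewrite fsetDUl (mem_fsetD1 iA).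
  by apply: fdisjointWr dAB; exact: fsubD1set.
have -> : partial i (0 : R) = 0 by rewrite /partial raddf0.
have [iA|iA] := boolP (i \in A); have [iB|iB] := boolP (i \in B); last first.
- by rewrite mul0r mulr0 addr0.
- rewrite mul0r add0r tmonM ifN //; apply: contra dAB => /fdisjointP h.
  apply/fdisjointP => x xA; have := h x xA.
  rewrite !inE negb_and negbK => /orP[/eqP xi|//].
  by rewrite xi (negbTE iA) in xA.
- rewrite mulr0 addr0 tmonM ifN //; apply: contra dAB => /fdisjointP h.
  apply/fdisjointP => x xA; have [->//|xi] := eqVneq x i.
  by apply: h; rewrite !inE xi.
(* When t_i divides both monomials their product is 0, while the two Leibniz terms are equal; they
   cancel because the characteristic is 2. *)
- rewrite !tmonM.
  have -> : [disjoint A `\ i & B]%fset = [disjoint A & B `\ i]%fset.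
    apply/fdisjointP/fdisjointP => h x xX.
      rewrite !inE negb_and negbK; case: eqVneq => //= xi.
      by apply: h; rewrite !inE xi.
    move: xX; rewrite !inE => /andP[xi /h]; by rewrite !inE xi.
  have -> : (A `|` B `\ i = A `\ i `|` B)%fset.
    apply/fsetP => x; rewrite !inE; case: eqVneq => [->|] //=.
    by rewrite iA iB.
  by rewrite trunc_addrr.
Qed.

Lemma pivot_tmon0 n A : (forall j, j \in A -> (j < n)%N) -> pivot n (tmon K A) = 0.
Proof.
move=> h; rewrite pivotU big_seq_cond big_pred0 // => j.
by apply/negP => /andP[/h]; rewrite ltnNge => /negbTE ->.
Qed.

Lemma pivot0 n : pivot n (0 : R) = 0.
Proof. exact: raddf0. Qed.

Lemma partial0 n : partial n (0 : R) = 0.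
Proof. exact: raddf0. Qed.

Lemma pivotD n f g : pivot n (f + g) = pivot n f + pivot n g.
Proof. exact: raddfD. Qed.

Lemma partialD n f g : partial n (f + g) = partial n f + partial n g.
Proof. exact: raddfD. Qed.

Lemma pivot_deriv n : (0 < n)%N -> is_deriv (@pivot K n).
Proof.
move=> n0; apply: deriv_of_tmon; first exact: pivot_linear.
move=> A B; have [N1 hA] := fset_nat_bound A; have [N2 hB] := fset_nat_bound B.
apply: (@nat_down_ind (fun n => pivot n (tmon K A * tmon K B) =
  pivot n (tmon K A) * tmon K B + tmon K A * pivot n (tmon K B)) (maxn N1 N2)) => [m|m nm IH].
  rewrite geq_max => /andP[N1m N2m].
  have hA' j : j \in A -> (j < m)%N by move=> /hA /leq_trans; exact.
  have hB' j : j \in B -> (j < m)%N by move=> /hB /leq_trans; exact.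
  rewrite (pivot_tmon0 hA') (pivot_tmon0 hB') mul0r mulr0 addr0 tmonM.
  case: ifP => _; last exact: pivot0.
  by apply: pivot_tmon0 => j; rewrite in_fsetU => /orP[/hA'|/hB'].
have m0 : (0 < m)%N by apply: leq_trans nm.
rewrite !(pivot_rec _ m0) IH partial_deriv.
by ring.
Qed.

Lemma partial_tvar i k : partial i (tvar K k) = (i == k)%:R.
Proof.
rewrite /tvar partialU in_fset1; case: eqVneq => // ->.
by rewrite fsetDv.
Qed.

Lemma partialC i j f : partial i (partial j f) = partial j (partial i f).
Proof.
apply: (trunc_lin_eq (F := partial i \o partial j) (G := partial j \o partial i)).
- by move=> a x y /=; rewrite !partial_linear.
- by move=> a x y /=; rewrite !partial_linear.
move=> A /=; rewrite !partialU.
have [iA|iA] := boolP (i \in A); have [jA|jA] := boolP (j \in A);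
  rewrite ?partial0 ?partialU ?(negbTE iA) ?(negbTE jA) //=.
- rewrite !in_fsetD1 iA jA !andbT eq_sym; case: eqP => //= _.
  by rewrite !fsetDDl fsetUC.
- by rewrite in_fsetD1 (negbTE jA) andbF.
- by rewrite in_fsetD1 (negbTE iA) andbF.
Qed.

(** The coefficients of v_(m+1) involve only t_m, t_(m+1), ..., none of which is t_j. *)
Lemma partial_pivotC j m f : (j < m)%N ->
  partial j (pivot m.+1 f) = pivot m.+1 (partial j f).
Proof.
move=> jm.
apply: (trunc_lin_eq (F := partial j \o pivot m.+1) (G := pivot m.+1 \o partial j)).
- by move=> a x y /=; rewrite pivot_linear partial_linear.
- by move=> a x y /=; rewrite partial_linear pivot_linear.
move=> A /=; have [N hA] := fset_nat_bound A.
apply: (@nat_down_ind (fun m => partial j (pivot m.+1 (tmon K A)) =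
  pivot m.+1 (partial j (tmon K A))) N m) => [k Nk|m' mm' IH].
  rewrite pivot_tmon0 => [|i /hA iN]; last by lia.
  rewrite partial0 partialU; case: ifP => _; last by rewrite pivot0.
  by rewrite pivot_tmon0 // => i; rewrite in_fsetD1 => /andP[_ /hA]; lia.
rewrite !(@pivot_rec K m'.+1) //= partialD partial_deriv IH partialC partial_tvar.
by rewrite (_ : (j == m') = false) ?mul0r ?add0r //; lia.
Qed.

(** In v_(m+1) = d/dt_(m+1) + t_m v_(m+2) the variable t_m occurs only as the displayed factor,
    whence the extra term v_(m+2). *)
Lemma partial_pivot m f :
  partial m (pivot m.+1 f) = pivot m.+1 (partial m f) + pivot m.+2 f.
Proof.
rewrite !(@pivot_rec K m.+1) //= partialD partial_deriv partial_tvar eqxx mul1r.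
by rewrite partial_pivotC // partialC -addrA [tvar _ _ * _ + _]addrC addrA.
Qed.

Lemma pivotM_tmon n A f : (0 < n)%N -> (forall j, j \in A -> (j < n)%N) ->
  pivot n (tmon K A * f) = tmon K A * pivot n f.
Proof. by move=> n0 h; rewrite pivot_deriv // pivot_tmon0 // mul0r add0r. Qed.

Lemma pivotM_tvar n k f : (k < n)%N ->
  pivot n (tvar K k * f) = tvar K k * pivot n f.
Proof.
move=> kn; apply: pivotM_tmon => [|j]; first exact: leq_ltn_trans kn.
by rewrite in_fset1 => /eqP ->.
Qed.

(** Induction on m - n with v_n = d/dt_n + t_(n-1) v_(n+1). The factor t_(n-1) passes through v_m
    and joins the product; d/dt_n commutes with v_m until m = n + 1, where it contributes v_(m+1)
    with an empty product. *)
Lemma pivotC n m f : (0 < n)%N -> (n < m)%N ->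
  pivot n (pivot m f) =
  pivot m (pivot n f) + \prod_(n.-1 <= k < m.-2) tvar K k * pivot m.+1 f.
Proof.
move=> n0; move En : (m - n)%N => d; elim: d n m n0 En => [|d IH] n m n0 En nm.
  by lia.
rewrite (@pivot_rec K n) // [pivot n f](@pivot_rec K n) // pivotD.
rewrite (pivotM_tvar (k := n.-1)); last by lia.
have [mn|mn] := eqVneq m n.+1.
  rewrite mn /= big_geq // mul1r partial_pivot.
  by rewrite -!addrA [X in _ + X]addrC.
case: m En nm mn => // m En nm mn.
rewrite (IH n.+1 m.+1) //; try by lia.
rewrite partial_pivotC; last by lia.
rewrite /= mulrDr mulrA addrA; congr (_ + _ * _).
case: n n0 En nm mn {IH} => // n _ En nm mn /=.
by rewrite [in RHS]big_ltn //; lia.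
Qed.

End Derivations.

(** * The basis of standard monomials *)

(* The multidegree of v_n, continued to v_0 so that t_n has multidegree - grv n. *)
Fixpoint grv (n : nat) : int * int :=
  match n with
  | 0 => (-1, 1)
  | 1 => (1, 0)
  | (k.+1 as m).+1 => grv m + grv k
  end.

Lemma grvSS n : grv n.+2 = grv n.+1 + grv n. Proof. by []. Qed.

(** Telescoping, since [grv k] is [grv k.+2 - grv k.+1]. *)
Lemma sum_grv a b : (a <= b)%N -> \sum_(a <= k < b) grv k = grv b.+1 - grv a.+1.
Proof.
elim: b => [|b IH]; first by rewrite leqn0 => /eqP ->; rewrite big_geq ?subrr.
rewrite leq_eqVlt => /predU1P[->|ab]; first by rewrite big_geq ?subrr.
by rewrite big_nat_recr //= IH // addrAC.
Qed.

Lemma big_fset_ord (T : Type) (idx : T) (op : Monoid.com_law idx) (N : nat)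
    (A : {fset nat}) (F : nat -> T) : (forall j, j \in A -> (j < N)%N) ->
  \big[op/idx]_(i <- A) F i = \big[op/idx]_(i < N | (i : nat) \in A) F i.
Proof.
move=> AN; rewrite -(big_mkord (fun i => i \in A)) -[RHS]big_filter.
apply: perm_big; apply: uniq_perm; rewrite ?fset_uniq ?filter_uniq ?iota_uniq //.
move=> i; rewrite mem_filter mem_index_iota /=.
by case: (boolP (i \in A)) => // /AN ->.
Qed.

(** The multidegree of the monomial t_A. *)
Definition dg (A : {fset nat}) : int * int := - \sum_(i <- A) grv i.

Lemma dg0 : dg fset0 = 0. Proof. by rewrite /dg big_seq_fset0 oppr0. Qed.

Lemma dgU (A B : {fset nat}) : [disjoint A & B]%fset -> dg (A `|` B)%fset = dg A + dg B.
Proof.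
move=> dAB; rewrite /dg -opprD -big_cat; congr (- _); apply: perm_big.
apply: uniq_perm; rewrite ?fset_uniq //.
  rewrite cat_uniq !fset_uniq andbT /=; apply/hasPn => x xB; apply/negP => /= xA.
  by have := fdisjointP dAB x xA; rewrite xB.
by move=> x; rewrite mem_cat in_fsetU.
Qed.

Lemma dg1 i : dg [fset i]%fset = - grv i.
Proof. by rewrite /dg big_seq_fset1. Qed.

Lemma dgD1 (A : {fset nat}) i : i \in A -> dg (A `\ i)%fset = dg A + grv i.
Proof. by move=> iA; rewrite /dg (big_fsetD1 i iA) opprD addrAC addNr add0r. Qed.

(** An explicit formula for [Gr], which selects a multidegree by choice; [Gr_gr] identifies the
    two. *)
Definition gr (w : stdmon) : int * int :=
  grv (lev w) - \sum_(i < lev w - 3) grv i *+ tagged w i.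

(** Exponents given by a set, so that products become unions. Elements of [A] outside the range
    allowed at level k + 1 are dropped, which is why the lemmas below bound the elements of [A]. *)
Definition mkstd (k : nat) (A : {fset nat}) : stdmon :=
  existT _ k [ffun i : 'I_(k.+1 - 3) => (i : nat) \in A].

Definition supp (w : stdmon) : {fset nat} :=
  [fset i in [seq val i | i <- enum 'I_(lev w - 3) & tagged w i]]%fset.

Lemma supp_lt w j : j \in supp w -> (j < lev w - 3)%N.
Proof. by rewrite inE /= => /mapP[i _ ->]. Qed.

Lemma stdmon_eta w : mkstd (tag w) (supp w) = w.
Proof.
case: w => k al; congr existT; apply/ffunP => i; rewrite ffunE inE /=.
rewrite mem_map; last exact: val_inj.
by rewrite mem_filter mem_enum andbT.
Qed.

Lemma stdmon_ind (P : stdmon -> Prop) :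
  (forall k A, (forall j, j \in A -> (j < k.+1 - 3)%N) -> P (mkstd k A)) ->
  forall w, P w.
Proof. by move=> h w; rewrite -(stdmon_eta w); apply: h; exact: supp_lt. Qed.

Lemma gr_mk k A : (forall j, j \in A -> (j < k.+1 - 3)%N) ->
  gr (mkstd k A) = grv k.+1 + dg A.
Proof.
move=> h; rewrite /gr /dg (big_fset_ord _ grv h) [in RHS]big_mkcond.
congr (_ - _); apply: eq_bigr => i _ /=; rewrite ffunE.
by case: ifP => _; rewrite ?mulr1n ?mulr0n.
Qed.

Section Basis.
Variable K : fieldType.
Local Notation R := (trunc K).
Local Notation sd := (stdmon_der K).
Implicit Types (A B : {fset nat}) (f g : R).

Lemma stdmon_der_mk k A : (forall j, j \in A -> (j < k.+1 - 3)%N) ->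
  sd (mkstd k A) = (fun f => tmon K A * pivot k.+1 f).
Proof.
move=> h; apply/funext => f; rewrite /stdmon_der; congr (_ * _).
rewrite tmonE (big_fset_ord _ (tvar K) h) [in RHS]big_mkcond.
apply: eq_bigr => i _ /=; rewrite ffunE.
by case: ifP => _; rewrite ?expr1 ?expr0.
Qed.

Definition tspan N d : set R :=
  lspan [set tmon K C | C in [set C : {fset nat} | (forall j, j \in C -> (j < N)%N) /\ dg C = d]].

Lemma tspan_subspace N d : subspace (tspan N d).
Proof. exact: lspan_subspace. Qed.

Lemma tspan_tmon N A : (forall j, j \in A -> (j < N)%N) -> tspan N (dg A) (tmon K A).
Proof. by move=> h; apply: lspan_gen; exists A. Qed.

Lemma tspan_tvar N k : (k < N)%N -> tspan N (- grv k) (tvar K k).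
Proof.
by move=> kN; rewrite -dg1; apply: tspan_tmon => j; rewrite in_fset1 => /eqP ->.
Qed.

Lemma tspanM N d d' f g : tspan N d f -> tspan N d' g -> tspan N (d + d') (f * g).
Proof.
move=> Hf Hg.
apply: (@lspan_linear _ _ _ (fun f => f * g) _ _ _ _ (tspan_subspace N (d + d')) _ Hf).
  by move=> a x y; rewrite mulrDl scalerAl.
move=> _ [A [AN <-] <-].
apply: (@lspan_linear _ _ _ (fun g => tmon K A * g) _ _ _ _ (tspan_subspace N (dg A + d')) _ Hg).
  by move=> a x y; rewrite mulrDr scalerAr.
move=> _ [B [BN <-] <-]; rewrite tmonM; case: ifPn => dAB.
  by rewrite -dgU //; apply: tspan_tmon => j; rewrite in_fsetU => /orP[/AN|/BN].
exact: (proj1 (tspan_subspace _ _)).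
Qed.

Lemma tspan_prod N a b : (b <= N)%N ->
  tspan N (- \sum_(a <= k < b) grv k) (\prod_(a <= k < b) tvar K k).
Proof.
elim: b => [|b IH] bN.
  by rewrite !big_geq // oppr0 -dg0; apply: tspan_tmon.
have [ab|ba] := leqP a b; last first.
  by rewrite !big_geq // oppr0 -dg0; apply: tspan_tmon.
rewrite !big_nat_recr //= opprD; apply: tspanM; last exact: tspan_tvar.
by apply: IH; exact: ltnW.
Qed.

(** The j-th term of v_n replaces t_j by t_(n-1) ... t_(j-2). By the telescoping [sum_grv] this
    changes the degree by [grv n] for every j, and it introduces only indices below j, so the bound
    N survives. *)
Lemma tspan_pivot N n B : (0 < n)%N -> (forall j, j \in B -> (j < N)%N) ->
  tspan N (dg B + grv n) (pivot n (tmon K B)).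
Proof.
move=> n0 BN; rewrite pivotU; apply: subspace_sum_seq; first exact: tspan_subspace.
move=> j jB nj; rewrite partialU jB.
have -> : dg B + grv n = - \sum_(n.-1 <= k < j.-1) grv k + dg (B `\ j)%fset.
  rewrite sum_grv; last by lia.
  rewrite !prednK ?(leq_trans n0 nj) // dgD1 //.
  by rewrite opprB [RHS]addrCA subrK.
apply: tspanM; first by apply: tspan_prod; have := BN j jB; lia.
by apply: tspan_tmon => i; rewrite in_fsetD1 => /andP[_]; exact: BN.
Qed.

Definition wspan d : set (R -> R) := lspan [set sd w | w in [set w | gr w = d]].

Lemma wspan_subspace d : subspace (wspan d).
Proof. exact: lspan_subspace. Qed.

Lemma tspan_wspan k d f : tspan (k.+1 - 3) d f ->
  wspan (grv k.+1 + d) (fun g => f * pivot k.+1 g).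
Proof.
apply: (@lspan_linear _ _ _ (fun f => (fun g => f * pivot k.+1 g) : R -> R)).
- by move=> a x y; apply/funext => g; rewrite mulrDl -scalerAl.
- exact: wspan_subspace.
move=> _ [A [AN <-] <-]; apply: lspan_gen; exists (mkstd k A).
  by rewrite /= gr_mk.
by rewrite stdmon_der_mk.
Qed.

Local Notation FW := {freeg stdmon / K}.

Definition of_coord : FW -> (R -> R) := fglift sd.

Lemma of_coord_linear : linear of_coord.
Proof. exact: linearP. Qed.

Lemma of_coordU w : of_coord << 1 *g w >> = sd w.
Proof. by rewrite /of_coord liftU scale1r. Qed.

Lemma pivot_tvar n : pivot n.+1 (tvar K n.+1) = 1.
Proof.
rewrite pivot_rec // partial_tvar eqxx pivot_tmon0 ?mulr0 ?addr0 // => j.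
by rewrite in_fset1 => /eqP ->.
Qed.

(* v_n kills t_k for k < n and maps t_n to 1, so evaluation at t_n detects the
   coefficients at the lowest level. *)
Lemma coeff_stdmon_der w z : (tag w <= tag z)%N ->
  coeff (supp w) (sd z (tvar K (lev w))) = (z == w)%:R.
Proof.
move=> wz; rewrite -{1}[z]stdmon_eta stdmon_der_mk; last exact: supp_lt.
have [e|ne] := eqVneq (tag w) (tag z).
  rewrite /lev e pivot_tvar mulr1 /tmon coeffU mul1r; congr (nat_of_bool _)%:R.
  have [->|zw] := eqVneq z w; first by rewrite eqxx.
  by apply/negbTE; apply: contra zw => /eqP szw; rewrite -[z]stdmon_eta -[w]stdmon_eta e szw.
rewrite pivot_tmon0; last first.
  by move=> j; rewrite in_fset1 => /eqP ->; rewrite /lev ltnS ltn_neqAle ne.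
rewrite mulr0 coeff0; case: eqVneq => // zw; by rewrite zw eqxx in ne.
Qed.

Lemma of_coord_inj : injective of_coord.
Proof.
move=> x y exy; apply/subr0_eq.
have : of_coord (x - y) = 0.
  have := of_coord_linear (-1) y x; rewrite [_ *: y]scaleN1r [- y + x]addrC => ->.
  by rewrite exy scaleN1r addNr.
move: (x - y) => {x y exy} x x0; apply/eqP/freeg_eqP => w; rewrite coeff0.
(* Evaluating at t_n, with n the level of w, kills all higher levels; the lower ones have zero
   coefficients by induction, so the coefficient of w remains. *)
move En : (tag w) => k; elim/ltn_ind: k w En => k IH w wk.
have : coeff (supp w) (of_coord x (tvar K (lev w))) = 0 by rewrite x0 coeff0.
rewrite /of_coord fgliftE fct_sumE raddf_sum /=.
have E z : coeff (supp w) ((coeff z x *: sd z) (tvar K (lev w))) = coeff z x * (z == w)%:R.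
  rewrite -[(coeff z x *: sd z) _]/(coeff z x *: sd z (tvar K (lev w))) coeffZ.
  have [wz|zw] := leqP (tag w) (tag z); first by rewrite coeff_stdmon_der.
  by rewrite (IH (tag z)) ?mul0r // -wk.
under eq_bigr do rewrite E.
have [wx|wx] := boolP (w \in dom x); last by rewrite (coeff_outdom wx).
rewrite (bigD1_seq w) ?uniq_dom //= eqxx mulr1 big1 ?addr0 // => z /negbTE ->.
by rewrite mulr0.
Qed.

Lemma lspan_of_coord (P : set stdmon) D : lspan [set sd w | w in P] D ->
  exists2 x, of_coord x = D & lspan [set (<< 1 *g w >> : FW) | w in P] x.
Proof.
apply: (@lspan_min _ _ _ [set D | exists2 x, of_coord x = D & lspan [set (<< 1 *g w >> : FW) | w in P] x]).
  split; first by exists 0; [exact: raddf0|exact: (proj1 (lspan_subspace _))].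
  move=> a _ _ [x <- Px] [y <- Py]; exists (a *: x + y); first exact: of_coord_linear.
  exact: (proj2 (lspan_subspace _)).
move=> _ [w Pw <-]; exists << 1 *g w >>; first exact: of_coordU.
by apply: lspan_gen; exists w.
Qed.

Definition der_coord (D : R -> R) : FW := xget 0 [set x | of_coord x = D].

Lemma of_coordK : cancel of_coord der_coord.
Proof.
move=> x; rewrite /der_coord; case: xgetP => [y -> /= /of_coord_inj//|/(_ x)/(_ erefl)//].
Qed.

Hypothesis char2 : 2%N \in [pchar K].

Lemma commutator_mk k l A B :
  (forall j, j \in A -> (j < k.+1 - 3)%N) -> (forall j, j \in B -> (j < l.+1 - 3)%N) ->
  (k < l)%N ->
  commutator (sd (mkstd k A)) (sd (mkstd l B)) =
  (fun f => tmon K A * pivot k.+1 (tmon K B) * pivot l.+1 f +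
    tmon K A * tmon K B * \prod_(k <= i < l.-1) tvar K i * pivot l.+2 f).
Proof.
move=> hA hB kl; apply/funext => f; rewrite !stdmon_der_mk // /commutator.
rewrite (pivot_deriv char2) // (pivotM_tmon char2 (n := l.+1)) //; last first.
  by move=> j /hA; lia.
rewrite (pivotC char2 (n := k.+1) (m := l.+1)) //=.
by ring.
Qed.

Lemma commutator_same k A B :
  (forall j, j \in A -> (j < k.+1 - 3)%N) -> (forall j, j \in B -> (j < k.+1 - 3)%N) ->
  commutator (sd (mkstd k A)) (sd (mkstd k B)) = 0.
Proof.
move=> hA hB; apply/funext => f; rewrite !stdmon_der_mk // /commutator.
rewrite !(pivotM_tmon char2 (n := k.+1)) //; try by move=> j; (move/hA || move/hB); lia.
by rewrite mulrCA subrr.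
Qed.

Lemma commutatorN D E : commutator D E = - commutator E D :> (R -> R).
Proof. by apply/funext => f; rewrite /commutator [RHS]opprB. Qed.

(** For levels k + 1 < l + 1 the commutator has two parts. In the one at level l + 1 the derivation
    v_(k+1) acts on t_B without raising the largest index; in the one at level l + 2 the new factor
    t_k ... t_(l-2) stays below the bound l - 1 of that level. Hence both parts lie in the span of
    standard monomials. *)
Lemma wspan_commutator w w' :
  wspan (gr w + gr w') (commutator (sd w) (sd w')).
Proof.
wlog ww' : w w' / (tag w <= tag w')%N.
  move=> H; case: (leqP (tag w) (tag w')) => [/H//|/ltnW/H].
  move=> h; rewrite commutatorN addrC -(@scaleN1r K).
  by apply: subspaceZ h; exact: wspan_subspace.
elim/stdmon_ind: w ww' => k A hA; elim/stdmon_ind: w' => l B hB /=.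
rewrite leq_eqVlt => /predU1P[kl|kl].
  move: hB; rewrite -{l}kl => hB; rewrite commutator_same //.
  exact: (proj1 (wspan_subspace _)).
rewrite commutator_mk // !gr_mk //.
pose T1 : R -> R := fun f => tmon K A * pivot k.+1 (tmon K B) * pivot l.+1 f.
pose T2 : R -> R := fun f => tmon K A * tmon K B *
  \prod_(k <= i < l.-1) tvar K i * pivot l.+2 f.
apply: (@subspaceD _ _ (wspan _) T1 T2); first exact: wspan_subspace.
  have -> : grv k.+1 + dg A + (grv l.+1 + dg B) =
            grv l.+1 + (dg A + (dg B + grv k.+1)).
    by rewrite addrCA addrA [grv k.+1 + _]addrC -!addrA [grv k.+1 + _]addrC.
  apply: tspan_wspan; apply: tspanM; last exact: tspan_pivot.
  by apply: tspan_tmon => j /hA; lia.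
have -> : grv k.+1 + dg A + (grv l.+1 + dg B) =
  grv l.+2 + (dg A + dg B - \sum_(k <= i < l.-1) grv i).
  case: l kl {T1 T2 hB} => // l kl.
  rewrite -pred_Sn sum_grv // [grv l.+3]grvSS.
  move: (grv l.+2) (grv l.+1) (grv k.+1) (dg A) (dg B) => [a1 a2] [b1 b2] [c1 c2] [d1 d2] [e1 e2].
  by congr pair; rewrite /=; ring.
apply: (@tspan_wspan l.+1); apply: tspanM.
  by apply: tspanM; apply: tspan_tmon => j; [move/hA|move/hB]; lia.
by apply: tspan_prod; lia.
Qed.

(** A commutator is linear in one argument only when the other argument is a linear map, so the
    members of a span have to be known to be linear before brackets can be expanded. *)
Lemma lspan_fun_linear (S : set (R -> R)) D :
  (forall D, S D -> linear D) -> lspan S D -> linear D.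
Proof.
move=> lS SD; apply: (lspan_min (B := [set E | linear E]) _ _ SD) => //; split=> /=.
  by move=> a x y; rewrite scaler0 addr0.
move=> a F G lF lG b x y.
have FGE u : (a *: F + G) u = a *: F u + G u by [].
by rewrite !FGE lF lG !scalerDr !scalerA mulrC addrACA.
Qed.

Lemma commutator_linear_l (E : R -> R) : linear E -> linear (fun D => commutator D E).
Proof.
move=> lE a F G; apply/funext => f; rewrite /commutator.
have FGE (F' G' : R -> R) u : (a *: F' + G') u = a *: F' u + G' u by [].
by rewrite !FGE lE scalerBr opprD addrACA.
Qed.

Lemma commutator_linear_r (D : R -> R) : linear D -> linear (commutator D).
Proof.
move=> lD a F G; apply/funext => f; rewrite /commutator.
have FGE (F' G' : R -> R) u : (a *: F' + G') u = a *: F' u + G' u by [].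
by rewrite !FGE lD scalerBr opprD addrACA.
Qed.

Lemma commutator_lspan (S S' T : set (R -> R)) D E :
  (forall D, S D -> linear D) -> (forall E, S' E -> linear E) -> subspace T ->
  (forall D E, S D -> S' E -> T (commutator D E)) ->
  lspan S D -> lspan S' E -> T (commutator D E).
Proof.
move=> lS lS' sT h SD SE; have lE := lspan_fun_linear lS' SE.
apply: (lspan_linear (commutator_linear_l lE) sT _ SD) => {D SD} D SD.
by apply: (lspan_linear (commutator_linear_r (lS _ SD)) sT _ SE) => F; exact: h.
Qed.

Lemma stdmon_der_linear w : linear (sd w).
Proof.
by move=> a x y; rewrite /stdmon_der pivot_linear mulrDr scalerAr.
Qed.

Lemma wspanM d d' D E : wspan d D -> wspan d' E -> wspan (d + d') (commutator D E).
Proof.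
apply: commutator_lspan; last 2 first.
- exact: wspan_subspace.
- by move=> _ _ [w <- <-] [w' <- <-]; exact: wspan_commutator.
- by move=> _ [w _ <-]; exact: stdmon_der_linear.
- by move=> _ [w _ <-]; exact: stdmon_der_linear.
Qed.

Lemma stdmon_der_mk0 k : sd (mkstd k fset0) = pivot k.+1.
Proof.
rewrite stdmon_der_mk //; apply/funext => f.
by rewrite -[tmon K fset0]/(1 : R) mul1r.
Qed.

Lemma gr_mk0 k : gr (mkstd k fset0) = grv k.+1.
Proof. by rewrite gr_mk // dg0 addr0. Qed.

Lemma commutator_mk0 k l B : (k < l)%N -> (forall j, j \in B -> (j < l.+1 - 3)%N) ->
  (forall j, j \in B -> (j < k.+1)%N) ->
  commutator (sd (mkstd k fset0)) (sd (mkstd l B)) =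
  (fun f => tmon K B * \prod_(k <= i < l.-1) tvar K i * pivot l.+2 f).
Proof.
move=> kl hB hB'; rewrite commutator_mk //; apply/funext => f.
by rewrite pivot_tmon0 // -[tmon K fset0]/(1 : R) mulr0 mul0r add0r mul1r.
Qed.

(** Induction on the level n. If t_(n-4) divides the monomial, it comes from [v_(n-3), v_(n-1)] =
    t_(n-4) v_n; otherwise [v_(n-2), v_(n-1)] = v_n is used. In both cases the left factor kills the
    remaining variables, and these are admissible at level n - 1. *)
Lemma commutator_of_stdmon w : exists a b : nat,
  gr w = (a%:Z, b%:Z) /\ commutator_of a b (sd w).
Proof.
elim/stdmon_ind: w => k; elim/ltn_ind: k => k IH A hA.
have A0 : (k.+1 - 3 = 0)%N -> A = fset0.
  by move=> k0; apply/fsetP => j; rewrite in_fset0; apply/negP => /hA; rewrite k0.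
case: k IH hA A0 => [|[|k]] IH hA A0.
- exists 1%N, 0%N; rewrite A0 // gr_mk0 stdmon_der_mk0; split => //; exact: CommPivot1.
- exists 0%N, 1%N; rewrite A0 // gr_mk0 stdmon_der_mk0; split => //; exact: CommPivot2.
have h0 n : forall j, j \in fset0 -> (j < n.+1 - 3)%N by [].
have [/andP[k0 kA]|kA] := boolP ((0 < k)%N && (k.-1 \in A)).
  case: k k0 kA IH hA A0 => // k _ /= kA IH hA A0.
  have hA' : forall j, j \in (A `\ k)%fset -> (j < k.+3 - 3)%N.
    by move=> j; rewrite in_fsetD1 => /andP[/eqP jk /hA]; lia.
  have [a [b [gab cab]]] := IH k (ltnW (ltnW (leqnn _))) fset0 (h0 _).
  have [c [d [gcd ccd]]] := IH k.+2 (leqnn _) _ hA'.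
  exists (a + c)%N, (b + d)%N; split.
    rewrite !PoszD -[(_, _)]/((a%:Z, b%:Z) + (c%:Z, d%:Z)) -gab -gcd.
    rewrite gr_mk // gr_mk0 gr_mk // dgD1 //.
    rewrite (_ : grv k.+4 = grv k.+3 + (grv k.+1 + grv k)) //.
    move: (grv k.+3) (grv k.+1) (grv k) (dg A) => [a1 a2] [b1 b2] [c1 c2] [d1 d2].
    by congr pair; rewrite /=; ring.
  have -> : sd (mkstd k.+3 A) = commutator (sd (mkstd k fset0)) (sd (mkstd k.+2 (A `\ k)%fset)).
    rewrite commutator_mk0 //; last by move=> j /hA'; lia.
    rewrite stdmon_der_mk //= big_nat1; apply/funext => f; congr (_ * _).
    rewrite /tvar tmonM ifT; first by rewrite fsetUC fsetD1K.
    by rewrite fdisjointX1 in_fsetD1 eqxx.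
  exact: CommBr.
have hA' : forall j, j \in A -> (j < k.+2 - 3)%N.
  move=> j jA; have := hA j jA.
  have : (0 < k)%N && (k.-1 == j) = false.
    by apply: contraNF kA => /andP[-> /eqP ->].
  by lia.
have [a [b [gab cab]]] := IH k (ltnW (leqnn _)) fset0 (h0 _).
have [c [d [gcd ccd]]] := IH k.+1 (leqnn _) _ hA'.
exists (a + c)%N, (b + d)%N; split.
  rewrite !PoszD -[(_, _)]/((a%:Z, b%:Z) + (c%:Z, d%:Z)) -gab -gcd.
  rewrite gr_mk // gr_mk0 gr_mk // grvSS.
  by rewrite -addrA addrCA.
have -> : sd (mkstd k.+2 A) = commutator (sd (mkstd k fset0)) (sd (mkstd k.+1 A)).
  rewrite commutator_mk0 //; last by move=> j /hA'; lia.
  by rewrite stdmon_der_mk //= big_geq // mulr1.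
exact: CommBr.
Qed.

Lemma commutator_of_fib a b D : @commutator_of K a b D -> fib_set D.
Proof.
elim=> {a b D} [B [_ h]|B [_ h]|a b c d D E _ IHD _ IHE B BP].
- by apply: h; left.
- by apply: h; right.
- by apply: (proj2 (proj1 BP)); [exact: IHD|exact: IHE].
Qed.

Lemma commutator_of_wspan a b D : @commutator_of K a b D -> wspan (a%:Z, b%:Z) D.
Proof.
elim=> {a b D} [||a b c d D E _ IHD _ IHE].
- by apply: lspan_gen; exists (mkstd 0 fset0); rewrite ?stdmon_der_mk0 //= gr_mk0.
- by apply: lspan_gen; exists (mkstd 1 fset0); rewrite ?stdmon_der_mk0 //= gr_mk0.
- by rewrite !PoszD -[(_, _)]/((a%:Z, b%:Z) + (c%:Z, d%:Z)); exact: wspanM.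
Qed.

Lemma stdmon_fib_set w : fib_set (sd w).
Proof. by have [a [b [_ /commutator_of_fib]]] := commutator_of_stdmon w. Qed.

Lemma val_stdmon_fib w : val (stdmon_fib K w) = sd w.
Proof. by rewrite /stdmon_fib val_insubd ifT //; apply/fibP; exact: stdmon_fib_set. Qed.

Lemma fib_set_lspan D : fib_set D -> lspan (range sd) D.
Proof.
apply; split.
  split; first exact: lspan_subspace.
  move=> F G; apply: commutator_lspan; last 2 first.
  - exact: lspan_subspace.
  - move=> _ _ [w _ <-] [w' _ <-].
    have /= := @wspan_commutator w w'; rewrite /wspan; apply: lspan_mono.
    by move=> _ [v _ <-]; exists v.
  - by move=> _ [w _ <-]; exact: stdmon_der_linear.
  - by move=> _ [w _ <-]; exact: stdmon_der_linear.
move=> _ [|] ->.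
- by apply: lspan_gen; exists (mkstd 0 fset0); rewrite ?stdmon_der_mk0.
- by apply: lspan_gen; exists (mkstd 1 fset0); rewrite ?stdmon_der_mk0.
Qed.

Lemma der_coordK D : fib_set D -> of_coord (der_coord D) = D.
Proof.
by move=> /fib_set_lspan /lspan_of_coord [x <- _]; rewrite of_coordK.
Qed.

(** Every commutator of this degree is a combination of standard monomials of the same degree, and a
    basis vector is not a combination of other ones. This makes the choice in [Gr] unambiguous. *)
Lemma fib_comp_gr a b w : fib_comp a b (sd w) -> gr w = (a%:Z, b%:Z).
Proof.
move=> h; have : wspan (a%:Z, b%:Z) (sd w).
  by apply: (lspan_min _ _ h); [exact: wspan_subspace|move=> D; exact: commutator_of_wspan].
move=> /lspan_of_coord[x]; rewrite -of_coordU => /of_coord_inj -> Hw.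
apply/eqP; rewrite -[_ == _]negbK; apply/negP => ne.
suff : coeff w (<< 1 *g w >> : FW) = 0.
  by rewrite coeffU eqxx mulr1 => /eqP; rewrite oner_eq0.
apply: (lspan_eq_linear (f := fun x : FW => coeff w x : K^o) (g := fun=> 0) _ _ _ Hw).
- by move=> c y z; rewrite coeffD coeffZ.
- by move=> c y z; rewrite scaler0 addr0.
move=> _ [v gv <-]; rewrite coeffU mul1r; case: eqP => // vw.
by rewrite -gv vw eqxx in ne.
Qed.

Lemma Gr_gr w : Gr K w = gr w.
Proof.
rewrite /Gr; have [a [b [gab cab]]] := commutator_of_stdmon w.
case: xgetP => [g _ [c [d [-> /fib_comp_gr ->]]]//|/(_ (gr w))[]].
by exists a, b; split=> //; exact: lspan_gen.
Qed.

End Basis.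

(** * Exterior powers in characteristic 2 *)

Section AltMap.
Variables (K : fieldType) (L : lmodType K) (n : nat).
Local Notation X := {ffun 'I_n -> L}.

(** The maps that factor through the exterior power, phrased with the same data as the generators in
    [ext_rel]. *)
Definition alt_map (V : lmodType K) (S : X -> V) : Prop :=
  (forall (i : 'I_n) (a : K) (x y z : X), z i = a *: x i + y i ->
     (forall k, k != i -> x k = z k /\ y k = z k) -> S z = a *: S x + S y) /\
  (forall (i j : 'I_n) (x : X), i != j -> x i = x j -> S x = 0).

Lemma fglift_ext_rel (V : lmodType K) (S : X -> V) r :
  alt_map S -> lspan (@ext_rel K L n) r -> fglift S r = 0.
Proof.
move=> [Sl Sa]; apply: (@lspan_linear _ _ _ (fglift S) _ [set 0]).
- exact: linearP.
- exact: subspace0.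
move=> _ [[i [a [x [y [z [zi zk ->]]]]]]|[i [j [x [ij xij ->]]]]] /=.
  rewrite !raddfB /= linearZ /= !liftU !scale1r (Sl i a x y z) //.
  by rewrite [_ *: _ + _ - _]addrAC subrr add0r subrr.
by rewrite liftU scale1r (Sa i j).
Qed.

(** It has the shape of [diff], so that [diff] is an instance by conversion and becomes well defined
    and linear once [diff_sym] is shown to be alternating. *)
Definition chain_lift (V : lmodType K) (S : X -> V) (u : chain L n) : V :=
  fglift S (rep u).

Lemma chain_lift_cl (V : lmodType K) (S : X -> V) r : alt_map S ->
  chain_lift S (cl _ r) = fglift S r.
Proof.
move=> aS; apply/subr0_eq; rewrite /chain_lift -raddfB.
by apply: fglift_ext_rel => //; apply/clE; rewrite repK.
Qed.

Lemma chain_lift_linear (V : lmodType K) (S : X -> V) : alt_map S ->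
  linear (chain_lift S).
Proof.
move=> aS a x y; rewrite -[x]repK -[y]repK; move: (rep x) (rep y) => {x y} x y.
have -> : a *: cl (@ext_rel K L n) x + cl _ y = cl _ (a *: x + y) by rewrite linearP.
by rewrite !chain_lift_cl // linearP.
Qed.

Definition wsym (x : X) : chain L n := cl (@ext_rel K L n) << 1 *g x >>.

Lemma wedge_wsym (x : 'I_n -> L) : wedge x = wsym [ffun i => x i].
Proof. by []. Qed.

Lemma chain_lift_wsym (V : lmodType K) (S : X -> V) x : alt_map S ->
  chain_lift S (wsym x) = S x.
Proof. by move=> aS; rewrite chain_lift_cl // liftU scale1r. Qed.

Lemma wsym_alt : alt_map wsym.
Proof.
split=> [i a x y z zi zk|i j x ij xij].
  apply/subr0_eq; rewrite /wsym opprD addrA -linearZ -!raddfB.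
  rewrite -[0](raddf0 (cl (@ext_rel K L n))); apply/clE; rewrite subr0.
  by apply: lspan_gen; left; exists i, a, x, y, z.
rewrite -[0](raddf0 (cl (@ext_rel K L n))); apply/clE; rewrite subr0.
by apply: lspan_gen; right; exists i, j, x.
Qed.

Lemma chain_ind (A : set (chain L n)) : subspace A -> (forall x, A (wsym x)) ->
  forall u, A u.
Proof.
move=> sA h u; rewrite -[u]repK; move: (rep u).
apply: freeg_lin_ind => [|a x y Ax Ay|//].
  by rewrite raddf0; exact: (proj1 sA).
by rewrite linearP; exact: (proj2 sA).
Qed.

Hypothesis char2 : 2%N \in [pchar K].

(** Polarization: the wedge with x_i + x_j in both slots vanishes, so a transposition changes the
    sign, and signs are invisible in characteristic 2. *)
Lemma wsym_tperm (x : X) i j : wsym [ffun k => x (tperm i j k)] = wsym x.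
Proof.
have [<-|ij] := eqVneq i j.
  by congr wsym; apply/ffunP => k; rewrite ffunE tperm1 perm1.
pose u a b : X := [ffun k => if k == i then a else if k == j then b else x k].
have ui a b : u a b i = a by rewrite ffunE eqxx.
have uj a b : u a b j = b by rewrite ffunE eq_sym (negbTE ij) eqxx.
have [wl wa] := wsym_alt.
have u1 a a' b : wsym (u (a + a') b) = wsym (u a b) + wsym (u a' b).
  rewrite -[wsym (u a b)]scale1r; apply: (wl i); rewrite ?ui ?scale1r //.
  by move=> k /negbTE ki; rewrite !ffunE ki.
have u2 a b b' : wsym (u a (b + b')) = wsym (u a b) + wsym (u a b').
  rewrite -[wsym (u a b)]scale1r; apply: (wl j); rewrite ?uj ?scale1r //.
  by move=> k /negbTE kj; rewrite !ffunE kj.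
have u0 a : wsym (u a a) = 0 by apply: (wa i j); rewrite ?ui ?uj.
have := u0 (x i + x j); rewrite u1 !u2 !u0 add0r addr0.
have -> : u (x i) (x j) = x.
  by apply/ffunP => k; rewrite ffunE; case: eqP => [->//|_]; case: eqP => [->|].
have -> : [ffun k => x (tperm i j k)] = u (x j) (x i).
  by apply/ffunP => k; rewrite !ffunE; case: tpermP => [->|->|/eqP/negbTE-> /eqP/negbTE->] //;
    rewrite ?eqxx // eq_sym (negbTE ij).
move=> /eqP; rewrite addr_eq0 => /eqP ->.
by rewrite -scaleN1r (oppr_pchar2 char2) scale1r.
Qed.

Lemma wsym_perm (s : 'S_n) (x : X) : wsym [ffun k => x (s k)] = wsym x.
Proof.
have [ts -> _] := prod_tpermP s; elim: ts x => [|t ts IH] x.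
  by rewrite big_nil; congr wsym; apply/ffunP => k; rewrite ffunE perm1.
rewrite big_cons -[RHS]IH -[RHS](wsym_tperm _ t.1 t.2).
by congr wsym; apply/ffunP => k; rewrite !ffunE permM.
Qed.

End AltMap.

Section Exterior.
Variables (K : fieldType) (L : lmodType K) (W : countType) (e : W -> L).
Local Notation FW := {freeg W / K}.
Variable c : L -> FW.
Hypothesis c_linear : linear c.
Hypothesis c_e : forall w, c (e w) = << 1 *g w >>.
Hypothesis cK : forall x, fglift e (c x) = x.
Local Notation R := (trunc K).

Lemma chain_span n (A : set (chain L n)) : subspace A ->
  (forall w : 'I_n -> W, injective w -> A (wedge_of e w)) -> forall u, A u.
Proof.
move=> sA h; apply: chain_ind => // x.
have h' (w : 'I_n -> W) : A (wedge_of e w).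
  have [/injectiveP/h //|/injectivePn[i [j ij wij]]] := boolP (injectiveb w).
  rewrite /wedge_of wedge_wsym (proj2 (@wsym_alt K L n) i j) //; first exact: (proj1 sA).
  by rewrite !ffunE wij.
(* The positions from k on already hold basis vectors; this is no condition for k = n. Each step
   expands the entry at one further position. *)
suff : forall k (x : {ffun 'I_n -> L}), (forall i : 'I_n, (k <= i)%N -> exists w, x i = e w) -> A (wsym x).
  by move=> /(_ n x); apply=> i; rewrite leqNgt ltn_ord.
elim=> {x} [|k IH] x hx.
  pose w i := projT1 (cid (hx i (leq0n _))).
  have -> : x = [ffun i => e (w i)].
    by apply/ffunP => i; rewrite ffunE /w; case: cid.
  exact: h'.
have [kn|nk] := ltnP k n; last by apply: IH => i ki; apply: hx; have := ltn_ord i; lia.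
pose ik := Ordinal kn.
pose y v : {ffun 'I_n -> L} := [ffun i => if i == ik then v else x i].
have -> : x = y (x ik) by apply/ffunP => i; rewrite ffunE; case: eqP => [->|].
rewrite -(cK (x ik)); move: (c (x ik)).
have [wl wa] := @wsym_alt K L n.
apply: freeg_lin_ind => [|a u v Hu Hv|w].
- rewrite raddf0.
  have -> : wsym (y 0) = 0; last exact: (proj1 sA).
  have -> : wsym (y 0) = -1 *: wsym (y 0) + wsym (y 0).
    by apply: (wl ik) => //; rewrite ffunE eqxx scaler0 addr0.
  by rewrite scaleN1r addNr.
- rewrite linearP (wl ik a (y (fglift e u)) (y (fglift e v))).
  + exact: (proj2 sA).
  + by rewrite !ffunE eqxx.
  + by move=> i /negbTE ki; rewrite !ffunE ki.
- rewrite liftU scale1r; apply: IH => i ki; rewrite ffunE; case: eqP => [_|/eqP ne].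
    by exists w.
  apply: hx; rewrite ltn_neqAle ki andbT; apply: contra ne => /eqP kki.
  exact/eqP/val_inj.
Qed.

Hypothesis char2 : 2%N \in [pchar K].

(* With one variable per basis vector, x_1 ^ ... ^ x_n is mapped to a product of
   linear forms; this embeds the exterior powers in a commutative ring. *)
Definition to_truncF : FW -> R := fglift (fun w => tvar K (choice.pickle w)).
Definition to_trunc (x : L) : R := to_truncF (c x).

Lemma to_trunc_linear : linear to_trunc.
Proof. by move=> a x y; rewrite /to_trunc c_linear /to_truncF linearP. Qed.

Lemma to_trunc_e w : to_trunc (e w) = tvar K (choice.pickle w).
Proof. by rewrite /to_trunc c_e /to_truncF liftU scale1r. Qed.

(* In characteristic 2 squaring is additive, and t_k^2 = 0. *)
Lemma to_trunc_sqr x : to_trunc x * to_trunc x = 0.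
Proof.
rewrite /to_trunc; move: (c x); apply: freeg_lin_ind => [|a u v Hu Hv|w].
- by rewrite /to_truncF raddf0 mul0r.
- have -> : to_truncF (a *: u + v) = a *: to_truncF u + to_truncF v by rewrite /to_truncF linearP.
  rewrite mulrDl !mulrDr -!scalerAl -!scalerAr Hu Hv !scaler0 add0r addr0.
  by rewrite [to_truncF v * _]mulrC (trunc_addrr char2).
- by rewrite /to_truncF liftU scale1r -expr2 tvar_sqr.
Qed.

Section Theta.
Variable n : nat.
Local Notation X := {ffun 'I_n -> L}.

Definition theta_sym (x : X) : R := \prod_i to_trunc (x i).

Lemma theta_alt : alt_map theta_sym.
Proof.
split=> [i a x y z zi zk|i j x ij xij]; rewrite /theta_sym.
  have B (u : X) : \prod_k to_trunc (u k) = to_trunc (u i) * \prod_(k | k != i) to_trunc (u k).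
    by rewrite (bigD1 i).
  rewrite !B zi to_trunc_linear mulrDl -scalerAl.
  congr (_ *: (_ * _) + _ * _); apply: eq_bigr => k /zk[]; first by move=> ->.
  by move=> _ ->.
rewrite (bigD1 i) //= (bigD1 j) /=; last by rewrite eq_sym.
by rewrite xij mulrA to_trunc_sqr mul0r.
Qed.

Definition theta : chain L n -> R := chain_lift theta_sym.

Lemma theta_linear : linear theta.
Proof. exact: chain_lift_linear theta_alt. Qed.

Lemma theta_wedge (x : 'I_n -> L) : theta (wedge x) = \prod_i to_trunc (x i).
Proof.
rewrite wedge_wsym /theta chain_lift_wsym; last exact: theta_alt.
by apply: eq_bigr => i _; rewrite ffunE.
Qed.

Definition img (w : 'I_n -> W) : {fset nat} :=
  [fset k in [seq choice.pickle (w i) | i <- enum 'I_n]]%fset.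

Lemma mem_img w k : reflect (exists i, k = choice.pickle (w i)) (k \in img w).
Proof.
rewrite inE /=; apply: (iffP mapP) => [[i _ ->]|[i ->]]; first by exists i.
by exists i => //; rewrite mem_enum.
Qed.

Lemma theta_wedge_of w : injective w -> theta (wedge_of e w) = tmon K (img w).
Proof.
move=> iw; rewrite theta_wedge; under eq_bigr do rewrite to_trunc_e.
rewrite tmonE -(big_map (fun i : 'I_n => choice.pickle (w i)) xpredT (tvar K)) /=.
apply: perm_big; apply: uniq_perm; rewrite ?fset_uniq //.
  rewrite map_inj_uniq ?index_enum_uniq // => i j.
  by move=> /(pcan_inj choice.pickleK) /iw.
move=> k; apply/mapP/mem_img => [[i _ ->]|[i ->]]; exists i => //.
by rewrite mem_index_enum.
Qed.

Lemma wedge_of_neq0 w : injective w -> wedge_of e w <> 0 :> chain L n.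
Proof.
move=> /theta_wedge_of; move=> + E; rewrite E.
rewrite (linear_fun0 theta_linear).
by move=> /esym/eqP; rewrite (negbTE (tmon_neq0 _ _)).
Qed.

Lemma img_perm w w' : injective w -> injective w' -> img w = img w' ->
  exists s : 'S_n, forall i, w' i = w (s i).
Proof.
move=> iw iw' ww'.
have h i : exists j, w' i = w j.
  have /mem_img[j E] : choice.pickle (w' i) \in img w by rewrite ww'; apply/mem_img; exists i.
  by exists j; apply: (pcan_inj choice.pickleK).
pose s i := projT1 (cid (h i)).
have hs i : w' i = w (s i) by rewrite /s; case: cid.
have is_ : injective s by move=> i j sij; apply: iw'; rewrite !hs sij.
by exists (perm is_) => i; rewrite permE.
Qed.

Variables (G : nmodType) (f : W -> G).

(* The default value 0 is taken on the t_A that are not the image of a wedge of n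
   basis vectors with degree in P. *)
Definition proj_tmon (P : pred G) (A : {fset nat}) : chain L n :=
  xget 0 [set u | exists w : 'I_n -> W,
    [/\ injective w, u = wedge_of e w, A = img w & P (\sum_i f (w i))]].

(** On monomials [theta] is undone by choosing a preimage wedge. Passing through [theta] makes the
    projection well defined and linear at once. *)
Definition proj (P : pred G) (u : chain L n) : chain L n :=
  fglift (proj_tmon P) (theta u).

Lemma proj_linear P : linear (proj P).
Proof. by move=> a x y; rewrite /proj theta_linear linearP. Qed.

Lemma proj0 P : proj P 0 = 0.
Proof. exact: linear_fun0 (proj_linear P). Qed.

Lemma proj_wedge P w : injective w ->
  proj P (wedge_of e w) = if P (\sum_i f (w i)) then wedge_of e w else 0.
Proof.
move=> iw; rewrite /proj theta_wedge_of // /tmon liftU scale1r /proj_tmon.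
have sum_perm w' (s : 'S_n) : (forall i, w' i = w (s i)) -> \sum_i f (w' i) = \sum_i f (w i).
  by move=> h; rewrite [RHS](reindex_perm s); apply: eq_bigr => i _; rewrite h.
(* The chosen w' differs from w by a permutation, which affects neither the degree nor, in
   characteristic 2, the wedge. *)
case: xgetP => [_ -> [w' [iw' -> ww' Pw']]|nex].
  have [s hs] := img_perm iw iw' ww'.
  rewrite -(sum_perm _ s hs) Pw' /wedge_of !wedge_wsym -[RHS](wsym_perm char2 s).
  by congr wsym; apply/ffunP => i; rewrite !ffunE hs.
by case: ifP => // Pw; case: (nex (wedge_of e w)); exists w.
Qed.

Lemma projT u : proj predT u = u.
Proof.
apply: (chain_span (A := [set u | proj predT u = u])) => [|w iw].
  split=> /=; first exact: proj0.
  by move=> a x y xE yE; rewrite proj_linear xE yE.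
by rewrite /= proj_wedge.
Qed.

Lemma proj_comp P u g : chain_comp e f n g u ->
  proj P u = if P g then u else 0.
Proof.
have idif (b : bool) : linear (fun u : chain L n => if b then u else 0).
  by move=> a x y; case: b => //; rewrite scaler0 addr0.
apply: (lspan_eq_linear (f := proj P) (g := fun u => if P g then u else 0)).
- exact: proj_linear.
- exact: idif.
by move=> _ [w [iw gw] <-]; rewrite proj_wedge // gw.
Qed.

Lemma wedge_of_comp (w : 'I_n -> W) : chain_comp e f n (\sum_i f (w i)) (wedge_of e w).
Proof.
have [/injectiveP iw|/injectivePn[i [j ij wij]]] := boolP (injectiveb w).
  by apply: lspan_gen; exists w.
rewrite /wedge_of wedge_wsym (proj2 (@wsym_alt K L n) i j) //.
  exact: (proj1 (lspan_subspace _)).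
by rewrite !ffunE wij.
Qed.

Lemma chain_comp_subspace g : subspace (chain_comp e f n g).
Proof. exact: lspan_subspace. Qed.

Lemma proj_in_comp g u : chain_comp e f n g (proj (pred1 g) u).
Proof.
apply: (chain_span (A := [set u | chain_comp e f n g (proj (pred1 g) u)])) => [|w iw].
  apply: (subspace_preimage (proj_linear _)); exact: chain_comp_subspace.
rewrite /= proj_wedge //=; case: eqP => [<-|_]; first exact: wedge_of_comp.
exact: (proj1 (chain_comp_subspace _)).
Qed.

Lemma chain_decomp (u : chain L n) : exists r : seq G,
  uniq r /\ u = \sum_(g <- r) proj (pred1 g) u.
Proof.
(* The claim for every duplicate-free list containing r is stable under sums: the lists of two
   summands are merged. *)
suff [r hr] : exists r : seq G, forall s, {subset r <= s} -> uniq s ->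
    u = \sum_(g <- s) proj (pred1 g) u.
  exists (undup r); rewrite undup_uniq; split=> //.
  by apply: hr; rewrite ?undup_uniq // => x; rewrite mem_undup.
apply: (chain_span (A := [set u | exists r : seq G, forall s, {subset r <= s} ->
  uniq s -> u = \sum_(g <- s) proj (pred1 g) u])) => [|w iw].
  split=> [|a x y [r hr] [r' hr']].
    by exists [::] => s _ _; rewrite big1 // => g _; exact: proj0.
  exists (r ++ r') => s rs us.
  under eq_bigr do rewrite proj_linear.
  rewrite big_split /= -scaler_sumr -hr -?hr' // => g gr; apply: rs.
    by rewrite mem_cat gr orbT.
  by rewrite mem_cat gr.
exists [:: \sum_i f (w i)] => s rs us.
rewrite (bigD1_seq (\sum_i f (w i))) //=; last by apply: rs; rewrite mem_head.
rewrite proj_wedge //= eqxx big1 ?addr0 // => g /negbTE ge.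
by rewrite proj_wedge //= eq_sym ge.
Qed.

End Theta.

Lemma theta_inj n : injective (@theta n).
Proof.
move=> u v uv; pose z (w : W) : nat := 0.
by rewrite -(projT z u) -(projT z v) /proj uv.
Qed.

(** * The differential and the gradings *)

Section Differential.
Variable br : L -> L -> L.
Hypothesis br_l : forall y, linear (br^~ y).
Hypothesis br_r : forall x, linear (br x).
Hypothesis brxx : forall x, br x x = 0.

Lemma lmod_addrr (x : L) : x + x = 0.
Proof. by rewrite -mulr2n -scaler_nat (pcharf0 char2) scale0r. Qed.

Lemma lmod_oppr (x : L) : - x = x.
Proof. by apply/eqP; rewrite eq_sym -addr_eq0 lmod_addrr. Qed.

Lemma brC x y : br x y = br y x.
Proof.
have := brxx (x + y).
rewrite (linear_funD (br_l _)) !(linear_funD (br_r _)) !brxx add0r addr0 => /eqP.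
by rewrite addr_eq0 lmod_oppr => /eqP.
Qed.

Section Dn.
Variable n : nat.
Local Notation X := {ffun 'I_n -> L}.
Local Notation th := (@theta n.-1).

(** The image under [theta] of the term of the differential that belongs to the pair i, j. *)
Definition contraction (x : X) (i j : 'I_n) : R :=
  to_trunc (br (x i) (x j)) * \prod_(l | (l != i) && (l != j)) to_trunc (x l).

Lemma size_others (i j : 'I_n) : i != j ->
  (size [seq l <- enum 'I_n | (l != i) && (l != j)]).+1 = n.-1.
Proof.
move=> ij; rewrite size_filter -[n in RHS]card_ord cardE.
rewrite -(count_predC (fun l => (l != i) && (l != j)) (enum 'I_n)).
have -> : count (predC (fun l => (l != i) && (l != j))) (enum 'I_n) = 2%N.
  rewrite -size_filter -[2%N](_ : size [:: i; j] = 2%N) //; apply: perm_size.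
  apply: uniq_perm; rewrite ?filter_uniq -?enumT ?enum_uniq //= ?inE ?ij //.
  by move=> l; rewrite mem_filter mem_enum !inE /= andbT negb_and !negbK.
by rewrite addn2.
Qed.

Lemma theta_diff_sym (x : X) :
  th (diff_sym br x) = \sum_(i < n) \sum_(j < n | (i < j)%N) contraction x i j.
Proof.
have th0 := linear_fun0 (@theta_linear n.-1).
have thD := linear_funD (@theta_linear n.-1).
rewrite /diff_sym (big_morph _ thD th0); apply: eq_bigr => i _.
rewrite (big_morph _ thD th0); apply: eq_bigr => j ij.
have -> : (-1) ^+ (i + j) = 1 :> K by rewrite (oppr_pchar2 char2) expr1n.
rewrite scale1r theta_wedge /contraction.
set s := br (x i) (x j) :: _.
have ss : size s = n.-1.
  by rewrite /= size_map size_others //; apply: contraTneq ij => ->; rewrite ltnn.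
rewrite -(big_mkord xpredT (fun k => to_trunc (nth 0 s k))) -ss -(big_nth _ xpredT to_trunc).
by rewrite big_cons big_map big_filter big_enum_cond.
Qed.

Lemma contraction_lin (i : 'I_n) (a : K) (x y z : X) (p q : 'I_n) : p != q ->
  z i = a *: x i + y i -> (forall k, k != i -> x k = z k /\ y k = z k) ->
  contraction z p q = a *: contraction x p q + contraction y p q.
Proof.
move=> pq zi zk; rewrite /contraction.
have P (u : X) : (forall k, k != i -> u k = z k) -> (i == p) || (i == q) ->
    \prod_(l | (l != p) && (l != q)) to_trunc (u l) =
    \prod_(l | (l != p) && (l != q)) to_trunc (z l).
  move=> uz ipq; apply: eq_bigr => l /andP[lp lq]; rewrite uz //.
  by case/orP: ipq => /eqP ->.
have zx k ki := proj1 (zk k ki); have zy k ki := proj2 (zk k ki).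
have [ip|ip] := eqVneq i p.
  have qi : q != i by rewrite ip eq_sym.
  subst p; rewrite !P ?eqxx // zi br_l to_trunc_linear (zx q qi) (zy q qi).
  by rewrite mulrDl -scalerAl.
have [iq|iq] := eqVneq i q.
  have pi : p != i by rewrite iq.
  subst q; rewrite !P ?eqxx ?orbT // zi br_r to_trunc_linear (zx p pi) (zy p pi).
  by rewrite mulrDl -scalerAl.
rewrite !(zx p, zy p, zx q, zy q) 1?eq_sym //.
have B (u : X) : \prod_(l | (l != p) && (l != q)) to_trunc (u l) =
    to_trunc (u i) * \prod_(l | (l != p) && (l != q) && (l != i)) to_trunc (u l).
  by rewrite (bigD1 i) //= ip iq.
have Q (u : X) : (forall k, k != i -> u k = z k) ->
    \prod_(l | (l != p) && (l != q) && (l != i)) to_trunc (u l) =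
    \prod_(l | (l != p) && (l != q) && (l != i)) to_trunc (z l).
  by move=> uz; apply: eq_bigr => l /andP[_ /uz ->].
rewrite !B !Q // zi to_trunc_linear mulrDl -scalerAl mulrDr -scalerAr.
by [].
Qed.

Lemma contraction_alt (x : X) (p q i j : 'I_n) : p != q -> x p = x q ->
  (i != p) && (i != q) && (j != p) && (j != q) ->
  contraction x i j = 0.
Proof.
move=> pq xpq /andP[/andP[/andP[ip iq] jp] jq].
rewrite /contraction (bigD1 p) /=; last by rewrite eq_sym ip eq_sym jp.
rewrite (bigD1 q) /=; last by rewrite eq_sym iq eq_sym jq eq_sym pq.
by rewrite xpq [to_trunc (x q) * (_ * _)]mulrA to_trunc_sqr mul0r mulr0.
Qed.

Lemma contractionC x i j : contraction x i j = contraction x j i.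
Proof. by rewrite /contraction brC; congr (_ * _); apply: eq_bigl => l; rewrite andbC. Qed.

Lemma contraction_swap (x : X) (p q j : 'I_n) : p != q -> x p = x q ->
  j != p -> j != q -> contraction x p j = contraction x q j.
Proof.
move=> pq xpq jp jq; rewrite /contraction (bigD1 q) /=; last first.
  by rewrite eq_sym pq eq_sym jq.
rewrite [in RHS](bigD1 p) /=; last by rewrite pq eq_sym jp.
rewrite xpq; congr (_ * (_ * _)); apply: eq_bigl => l.
by rewrite andbAC [RHS]andbAC; congr (_ && _); rewrite andbC.
Qed.

(** Alternation, for x_p = x_q: the pair {p, q} contributes [x_p, x_p] = 0, a pair disjoint from {p,
    q} leaves a square as a factor, and the pairs {p, j} and {q, j} contribute equal terms, which
    cancel in characteristic 2. *)
Lemma diff_sym_alt : alt_map (@diff_sym K L br n).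
Proof.
have lin := @theta_linear n.-1.
split=> [i a x y z zi zk|p q x pq xpq]; apply: theta_inj.
  rewrite lin !theta_diff_sym scaler_sumr -big_split; apply: eq_bigr => k _ /=.
  rewrite scaler_sumr -big_split; apply: eq_bigr => l kl /=.
  by apply: (@contraction_lin i) => //; apply: contraTneq kl => ->; rewrite ltnn.
rewrite (linear_fun0 lin) theta_diff_sym.
pose in2 (i : 'I_n) := (i == p) || (i == q).
pose T := contraction x.
(* Pairs with exactly one member in {p, q}, oriented so that this member comes first. The sum over i
   < j then turns into a full double sum whose only nonzero rows are p and q. *)
pose A i j := if in2 i && ~~ in2 j then T i j else 0.
have E (i j : 'I_n) : (i < j)%N -> T i j = A i j + A j i.
  rewrite /A => ij; have ne : i != j by apply: contraTneq ij => ->; rewrite ltnn.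
  have [i2|i2] := boolP (in2 i); have [j2|j2] := boolP (in2 j); rewrite /= ?addr0 ?add0r //.
  - rewrite /T /contraction; have -> : x i = x j.
      by move: i2 j2; rewrite /in2 => /orP[]/eqP -> /orP[]/eqP ->.
    by rewrite brxx (linear_fun0 to_trunc_linear) mul0r.
  - exact: contractionC.
  - apply: (@contraction_alt x p q) => //.
    by move: i2 j2; rewrite /in2 !negb_or => /andP[-> ->] /andP[-> ->].
have -> : \sum_(i < n) \sum_(j < n | (i < j)%N) contraction x i j =
    \sum_(i < n) (\sum_(j < n | (i < j)%N) A i j + \sum_(j < n | (i < j)%N) A j i).
  apply: eq_bigr => i _; rewrite -big_split /=; apply: eq_bigr => j; exact: E.
rewrite big_split /= [X in _ + X](exchange_big_dep xpredT) //= -big_split /=.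
rewrite (eq_bigr (fun i => \sum_j A i j)); last first.
  move=> i _; rewrite [in RHS](bigID (fun j : 'I_n => (i < j)%N)) /=; congr (_ + _).
  rewrite [LHS]big_mkcond [RHS]big_mkcond /=; apply: eq_bigr => j _.
  rewrite /A; have [ij|ij] := boolP (in2 i && ~~ in2 j); last by rewrite !if_same.
  case: ltngtP => // /val_inj ji; move: ij; rewrite ji andbN //.
rewrite (bigD1 p) //= [X in _ + X](bigD1 q) /=; last by rewrite eq_sym.
rewrite [X in _ + (_ + X)]big1 => [|i /andP[ip iq]]; last first.
  by rewrite /A /in2 (negbTE ip) (negbTE iq) /= big1.
rewrite addr0 -big_split big1 // => j _ /=; rewrite /A /in2 !eqxx orbT /=.
case: ifP => [|_]; last by rewrite addr0.
rewrite negb_or => /andP[jp jq].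
by rewrite /T (contraction_swap pq) // (trunc_addrr char2).
Qed.

Lemma diffE : @Defs.diff K L br n = chain_lift (@diff_sym K L br n).
Proof. by []. Qed.

Lemma diff_linear : linear (@Defs.diff K L br n).
Proof. exact: chain_lift_linear diff_sym_alt. Qed.

Lemma diff_wedge (x : 'I_n -> L) : Defs.diff br (wedge x) = diff_sym br [ffun i => x i].
Proof. by rewrite wedge_wsym diffE chain_lift_wsym //; exact: diff_sym_alt. Qed.

Variables (G : nmodType) (f : W -> G).
Hypothesis br_homog : forall w w',
  lspan [set e v | v in [set v | f v = f w + f w']] (br (e w) (e w')).

Lemma diff_wedge_of (w : 'I_n -> W) :
  chain_comp e f n.-1 (\sum_i f (w i)) (Defs.diff br (wedge_of e w)).
Proof.
have sC := @chain_comp_subspace n.-1 G f.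
rewrite diff_wedge; apply: (subspace_sum _ (sC _)) => i _; apply: (subspace_sum _ (sC _)) => j ij.
have ne : i != j by apply: contraTneq ij => ->; rewrite ltnn.
apply: (subspaceZ _ (sC _)); rewrite !ffunE.
set s := [seq l <- _ | _].
have -> : [seq [ffun i => e (w i)] l | l <- s] = [seq e v | v <- [seq w l | l <- s]].
  by rewrite -map_comp; apply: eq_map => l /=; rewrite ffunE.
set ws := map w s.
have ss : (size ws).+1 = n.-1 by rewrite size_map size_others.
have -> : \sum_i f (w i) = f (w i) + f (w j) + \sum_(v <- ws) f v.
  rewrite (bigD1 i) //= (bigD1 j) /= 1?eq_sym // addrA; congr (_ + _).
  by rewrite big_map big_filter big_enum_cond.
have n0 : (0 < n.-1)%N by rewrite -ss.
(* The bracket occupies the first slot; linearity there allows it to be replaced by basis vectors v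
   of degree f w_i + f w_j. If v repeats another entry the wedge is 0, which lies in every
   component. *)
pose F (v : L) : chain L n.-1 := wedge (fun k : 'I_n.-1 => nth 0 (v :: map e ws) k).
have Flin : linear F.
  move=> a u v; rewrite /F !wedge_wsym.
  apply: (proj1 (@wsym_alt K L n.-1) (Ordinal n0)); first by rewrite !ffunE.
  by move=> k k0; rewrite !ffunE; case: k k0 => [[|k] hk].
rewrite -[wedge _]/(F (br (e (w i)) (e (w j)))).
apply: (@lspan_linear _ _ _ F _ _ _ Flin (sC _) _ (@br_homog (w i) (w j))).
move=> _ [v <- <-]; rewrite /F.
pose w' (k : 'I_n.-1) := nth v (v :: ws) k.
have -> : wedge (fun k : 'I_n.-1 => nth 0 (e v :: [seq e v | v <- ws]) k) = wedge_of e w'.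
  rewrite /wedge_of !wedge_wsym; congr wsym; apply/ffunP => k; rewrite !ffunE.
  by rewrite -map_cons (nth_map v) //= ss.
have -> : f v + \sum_(v <- ws) f v = \sum_k f (w' k).
  by rewrite -[LHS](big_cons _ +%R v ws xpredT f) (big_nth v) [size _]ss big_mkord.
exact: wedge_of_comp.
Qed.

Lemma diff_homog : diff_homogeneous br e f n.
Proof.
move=> g u; apply: (@lspan_linear _ _ _ (@Defs.diff K L br n)).
- exact: diff_linear.
- exact: chain_comp_subspace.
by move=> _ [w [_ <-] <-]; exact: diff_wedge_of.
Qed.

(** The source of the grading on homology: the components of a cycle are cycles, and those of a
    boundary are boundaries. *)
Lemma diff_proj P u : Defs.diff br (proj f P u : chain L n) = proj f P (Defs.diff br u).
Proof.
apply: (chain_span (A := [set u : chain L n | Defs.diff br (proj f P u) = proj f P (Defs.diff br u)])).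
  split=> [/=|a x y /= xE yE]; first by rewrite proj0 (linear_fun0 diff_linear) proj0.
  by rewrite proj_linear !diff_linear proj_linear xE yE.
move=> w iw /=; rewrite (proj_comp P (@diff_wedge_of w)) proj_wedge //.
by case: ifP => // _; exact: linear_fun0 diff_linear.
Qed.

End Dn.

Section Graded.
Variables (G : nmodType) (f : W -> G).
Hypothesis br_homog : forall w w',
  lspan [set e v | v in [set v | f v = f w + f w']] (br (e w) (e w')).
Section GradedN.
Variable n : nat.

Local Notation hcl := (@hclass K L br n).
Local Notation comp := (chain_comp e f n).

Lemma diff0 m : Defs.diff br (0 : chain L m) = 0.
Proof. exact: linear_fun0 (@diff_linear m). Qed.

Lemma cycles_subspace : subspace (cycles br n).
Proof.
split; first by rewrite /cycles /= diff0.
move=> a x y xE yE; change (Defs.diff br (a *: x + y) = 0).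
have {}xE : Defs.diff br x = 0 by exact: xE.
have {}yE : Defs.diff br y = 0 by exact: yE.
rewrite (@diff_linear n a x y).
by rewrite xE yE scaler0 add0r.
Qed.

Lemma boundaries_subspace : subspace (@boundaries K L br n).
Proof.
split; first by exists 0 => //; exact: (@diff0 n.+1).
move=> a _ _ [x _ <-] [y _ <-]; exists (a *: x + y) => //.
exact: (@diff_linear n.+1 a x y).
Qed.

Lemma hclass_linear : linear hcl.
Proof. by move=> a x y; rewrite /hclass linearP. Qed.

Lemma hclass_eq z z' : hcl z = hcl z' -> @boundaries K L br n (z - z').
Proof.
move=> /clE; apply: lspan_min => //; exact: boundaries_subspace.
Qed.

Lemma hclass_eq0 z : hcl z = 0 <-> @boundaries K L br n z.
Proof.
have h0 : hcl 0 = 0 by rewrite /hclass raddf0.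
split=> [|bz]; first by rewrite -h0 => /hclass_eq; rewrite subr0.
by rewrite -h0; apply/clE; rewrite subr0; exact: lspan_gen.
Qed.

Lemma boundaries_proj P (z : chain L n) :
  @boundaries K L br n z -> @boundaries K L br n (proj f P z).
Proof.
by move=> [u _ <-]; exists (proj f P u) => //; exact: (@diff_proj n.+1 G f br_homog).
Qed.

Lemma cycles_proj P z : cycles br n z -> cycles br n (proj f P z).
Proof. by rewrite /cycles /= => zc; rewrite diff_proj // zc proj0. Qed.

Lemma comp_proj g z : comp g z -> proj f (pred1 g) z = z.
Proof. by move=> zg; rewrite (proj_comp _ zg) /= eqxx. Qed.

Lemma comp_proj_neq g g' z : comp g z -> g != g' -> proj f (pred1 g') z = 0.
Proof. by move=> zg /negbTE gg'; rewrite (proj_comp _ zg) /= gg'. Qed.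

Lemma chain_degE g z : z <> 0 -> comp g z -> chain_deg e f z = g.
Proof.
move=> z0 zg; rewrite /chain_deg; case: xgetP => [g' _ zg'|/(_ g)//].
apply/eqP; apply: contra_notT z0 => gg'.
by rewrite -(comp_proj zg); exact: comp_proj_neq zg' gg'.
Qed.

(** Projecting the boundary z - z' to degree g leaves z, so z is itself a boundary. Hence a nonzero
    class has only one degree. *)
Lemma hclass_comp_neq g g' z z' : comp g z -> comp g' z' -> hcl z = hcl z' ->
  g != g' -> hcl z = 0.
Proof.
move=> zg zg' zz' gg'; apply/hclass_eq0.
have := boundaries_proj (pred1 g) (hclass_eq zz').
have -> : z - z' = -1 *: z' + z by rewrite scaleN1r addrC.
rewrite proj_linear (comp_proj zg) (comp_proj_neq zg') 1?eq_sym //.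
by rewrite scaler0 add0r.
Qed.

Lemma hom_degE g h : h <> 0 -> hom_comp br e f n g h -> hom_deg br e f h = g.
Proof.
move=> h0 hg; rewrite /hom_deg; case: xgetP => [g' _|/(_ g)//].
move=> [z' [_ zg'] zh']; case: hg => z [_ zg] zh.
apply/eqP; apply: contra_notT h0 => gg'.
by rewrite -zh'; apply: hclass_comp_neq zg' zg _ gg'; rewrite zh'.
Qed.

(** If no wedge from [T] had degree g, projection to g would kill the whole span, hence z. This
    carries inequalities from wedges over to homogeneous classes. *)
Lemma lspan_deg_ex (T : set ('I_n -> W)) g z : (forall w, T w -> injective w) ->
  lspan [set wedge_of e w | w in T] z -> comp g z -> z <> 0 ->
  exists w, T w /\ \sum_i f (w i) = g.
Proof.
move=> Ti Tz zg; apply: contra_notP => nex; rewrite -(comp_proj zg).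
apply: (lspan_eq_linear (f := proj f (pred1 g)) (g := fun=> 0) _ _ _ Tz).
- exact: proj_linear.
- by move=> a x y; rewrite scaler0 addr0.
move=> _ [w Tw <-]; rewrite proj_wedge //; last exact: Ti.
by rewrite /=; case: eqP => // wg; case: nex; exists w.
Qed.

Lemma comp_deg_ex g z : comp g z -> z <> 0 ->
  exists w : 'I_n -> W, injective w /\ \sum_i f (w i) = g.
Proof.
move=> zg z0; have [w [[iw wg] _]] := lspan_deg_ex (T := [set w : 'I_n -> W |
  injective w /\ \sum_i f (w i) = g]) (fun w Tw => proj1 Tw) zg zg z0.
by exists w.
Qed.

Lemma hom_comp_deg_ex g h : h <> 0 -> hom_comp br e f n g h ->
  exists w : 'I_n -> W, injective w /\ \sum_i f (w i) = g.
Proof.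
move=> h0 [z [_ zg] zh]; apply: comp_deg_ex zg _ => z0.
by apply: h0; rewrite -zh z0 /hclass raddf0.
Qed.

Lemma hom_comp_lspan g : hom_comp br e f n g `<=`
  lspan [set hcl (wedge_of e w) | w in
    [set w : 'I_n -> W | injective w /\ \sum_i f (w i) = g]].
Proof.
move=> _ [z [_ zg] <-].
apply: (@lspan_linear _ _ _ hcl _ _ _ hclass_linear (lspan_subspace _) _ zg).
by move=> _ [w wg <-]; apply: lspan_gen; exists w.
Qed.

Lemma degree_extendsP : degree_extends br e f n.
Proof.
split.
- move=> w iw; have w0 := wedge_of_neq0 iw; split=> //.
  by apply: chain_degE => //; exact: wedge_of_comp.
- by move=> g u; exact: chain_degE.
- by split; exact: diff_homog.
- by move=> g z zc zg z0; apply: hom_degE => //; exists z.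
Qed.

Lemma gradedP : graded br e f n.
Proof.
split; last 1 first.
- split.
  + move=> g; split; last by move=> _ [z [zc _] <-]; exists z.
    have [c0 cD] := cycles_subspace; have [s0 sD] := chain_comp_subspace n f g.
    split; first by exists 0; rewrite /hclass ?raddf0.
    move=> a _ _ [z [zc zg] <-] [z' [zc' zg'] <-].
    exists (a *: z + z'); last exact: hclass_linear.
    by split; [exact: cD|exact: sD].
  + move=> _ [z zc <-]; have [r [_ zr]] := chain_decomp f z.
    exists r, (fun g => hcl (proj f (pred1 g) z)); split.
      move=> g; exists (proj f (pred1 g) z) => //.
      by split; [exact: cycles_proj|exact: proj_in_comp].
    by rewrite [in LHS]zr /hclass raddf_sum.
  + move=> r F ur Fg.
    have Fg' g : exists z, (cycles br n z /\ comp g z) /\ hcl z = F g.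
      by have [z zP zF] := Fg g; exists z.
    pose z g := projT1 (cid (Fg' g)).
    have zP g : (cycles br n (z g) /\ comp g (z g)) /\ hcl (z g) = F g.
      by rewrite /z; case: cid.
    have -> : \sum_(g <- r) F g = hcl (\sum_(g <- r) z g).
      by rewrite /hclass raddf_sum; apply: eq_bigr => g _; case: (zP g) => _ <-.
    move=> /hclass_eq0 zb g gr; have [[_ zg] <-] := zP g; apply/hclass_eq0.
    suff <- : proj f (pred1 g) (\sum_(g <- r) z g) = z g by exact: boundaries_proj.
    have pD := linear_funD (@proj_linear n G f (pred1 g)).
    rewrite (big_morph _ pD (proj0 _ f _)) (bigD1_seq g) //= (comp_proj zg).
    rewrite big1 ?addr0 // => g' g'g; apply: comp_proj_neq g'g.
    by case: (zP g') => [[]].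
- split.
  + by move=> g; split=> //; exact: chain_comp_subspace.
  + move=> u _; have [r [_ ur]] := chain_decomp f u.
    by exists r, (fun g => proj f (pred1 g) u); split=> // g; exact: proj_in_comp.
  + move=> r F ur Fg F0 g gr.
    have pD := linear_funD (@proj_linear n G f (pred1 g)).
    have : proj f (pred1 g) (\sum_(g <- r) F g) = 0 by rewrite F0 proj0.
    rewrite (big_morph _ pD (proj0 _ f _)) (bigD1_seq g) //= (comp_proj (Fg g)).
    rewrite big1 ?addr0 // => g' g'g; exact: comp_proj_neq g'g.
- by split; exact: diff_homog.
Qed.

End GradedN.

(** The hypotheses on v make the degree g part of the complex zero in positions n - 1 and n + 1, so
    in this degree the differentials into and out of position n vanish. *)
Lemma homology_neq0 n g (w : 'I_n -> W) : injective w -> \sum_i f (w i) = g ->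
  (forall v : 'I_n.-1 -> W, injective v -> \sum_i f (v i) <> g) ->
  (forall v : 'I_n.+1 -> W, injective v -> \sum_i f (v i) <> g) ->
  exists2 h, homology br n h & h <> 0.
Proof.
move=> iw wg lo hi.
have zg : chain_comp e f n g (wedge_of e w) by rewrite -wg; exact: wedge_of_comp.
exists (hclass br (wedge_of e w)).
  exists (wedge_of e w) => //; rewrite /cycles /=.
  have dg := diff_homog br_homog zg; apply: contrapT => d0.
  by have [v [iv vg]] := comp_deg_ex dg d0; exact: lo vg.
move=> /hclass_eq0 [u _ du].
have := diff_proj br_homog (pred1 g) u; rewrite [in RHS]du.
rewrite [RHS](comp_proj zg).
have -> : proj f (pred1 g) u = 0.
  apply: contrapT => u0.
  by have [v [iv vg]] := comp_deg_ex (@proj_in_comp _ _ f g u) u0; exact: hi vg.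
by rewrite (@diff0 n.+1) => /esym; exact: wedge_of_neq0.
Qed.

End Graded.
End Differential.
End Exterior.

(** * Weights *)

Section Numerics.
Variable RR : realType.
Local Notation l := (lam RR).
Local Notation b := (lambar RR).

Lemma sqr_sqrt5 : Num.sqrt 5%:R ^+ 2 = 5%:R :> RR.
Proof. by rewrite sqr_sqrtr // ler0n. Qed.

Lemma lam_sqr : l ^+ 2 = l + 1.
Proof. by rewrite /lam; have := sqr_sqrt5; lra. Qed.

Lemma lambar_sqr : b ^+ 2 = b + 1.
Proof. by rewrite /lambar; have := sqr_sqrt5; lra. Qed.

Lemma lambarE : b = 1 - l.
Proof. by rewrite /lam /lambar; lra. Qed.

Lemma lam_gt1 : 1 < l.
Proof.
rewrite /lam; have : 1 < Num.sqrt 5%:R :> RR by rewrite -{1}sqrtr1 ltr_sqrt ?ltr1n.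
by lra.
Qed.

Lemma lam_lt2 : l < 2%:R.
Proof. by have := lam_sqr; have := lam_gt1; nra. Qed.

Lemma lam_gt0 : 0 < l.
Proof. exact: lt_trans ltr01 lam_gt1. Qed.

Lemma lamM_lambar : l * b = -1.
Proof. by rewrite lambarE; have := lam_sqr; lra. Qed.

(** The weight of an element of multidegree g, for x = lambda, and its superweight, for x the
    conjugate. *)
Definition ev (x : RR) (g : int * int) : RR := g.1%:~R * x + g.2%:~R * x ^+ 2.

Lemma evB x g h : ev x (g - h) = ev x g - ev x h.
Proof. by rewrite /ev /= !rmorphB /=; ring. Qed.

Lemma evD x g h : ev x (g + h) = ev x g + ev x h.
Proof. by rewrite /ev /= !rmorphD /=; ring. Qed.

Lemma ev0 x : ev x 0 = 0.
Proof. by rewrite /ev /= !mul0r addr0. Qed.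

Lemma ev_sum x (I : Type) (r : seq I) (P : pred I) (F : I -> int * int) :
  ev x (\sum_(i <- r | P i) F i) = \sum_(i <- r | P i) ev x (F i).
Proof. exact: (big_morph (ev x) (evD x) (ev0 x)). Qed.

Lemma ev_grv x n : x ^+ 2 = x + 1 -> ev x (grv n) = x ^+ n.
Proof.
move=> xE; elim/ltn_ind: n => [[|[|n]]] IH.
- by rewrite /ev /= xE expr0; ring.
- by rewrite /ev /= expr1; ring.
- by rewrite grvSS evD !IH // -[n.+2]add2n exprD xE mulrDl mul1r -exprS.
Qed.

Lemma weight_ev x w : x ^+ 2 = x + 1 -> weight x w = ev x (gr w).
Proof.
move=> xE; rewrite /weight /gr evB ev_grv // ev_sum; congr (_ - _).
apply: eq_bigr => i _; rewrite -(ev_grv _ xE).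
by case: (tagged w i); rewrite ?mulr1n ?mulr0n ?mul1r ?mul0r ?ev0.
Qed.

Lemma Wt_ev w : Wt RR w = (ev l (gr w), ev b (gr w)).
Proof.
by rewrite /Wt !weight_ev //; [exact: lambar_sqr|exact: lam_sqr].
Qed.

Lemma weight_lam_le w : weight l w <= l ^+ lev w.
Proof.
rewrite /weight lerBlDr lerDl; apply: sumr_ge0 => i _.
by rewrite mulr_ge0 ?ler0n // exprn_ge0 // ltW // lam_gt0.
Qed.

Lemma sum_lam n : \sum_(i < n) l ^+ i = l ^+ n.+1 - l.
Proof.
elim: n => [|n IH]; first by rewrite big_ord0 expr1 subrr.
by rewrite big_ord_recr /= IH -[n.+2]addn2 exprD lam_sqr exprS; ring.
Qed.

(** At level n >= 3 the least weight has all exponents equal to 1, and by [sum_lam] it is lambda^n -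
    lambda^(n-2) + lambda = lambda^(n-1) + lambda. Levels 1 and 2 contain no t_i. *)
Lemma weight_lam_gt w : l ^+ (lev w).-1 < weight l w.
Proof.
have l0 := lam_gt0; have l1 := lam_gt1.
have h : \sum_(i < lev w - 3) (tagged w i)%:R * l ^+ i <= l ^+ (lev w - 3).+1 - l.
  rewrite -sum_lam; apply: ler_sum => i _.
  by case: (tagged w i); rewrite ?mul1r // mul0r exprn_ge0 // ltW.
rewrite /weight; move: h; set S := \sum_(i < _) _; rewrite /lev.
have [k3 h|k3 _] := leqP 2 (tag w).
  have := subnK k3; move: (tag w - 2)%N => k kE.
  move: h; rewrite -kE (_ : (k + 2).+1 - 3 = k)%N; last by lia.
  have -> : (k + 2).+1.-1 = k.+2 by lia.
  have -> : (k + 2).+1 = k.+3 by lia.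
  rewrite (exprS l k.+2) (exprS l k.+1); move: (l ^+ k.+1) => X.
  by rewrite mulrA -expr2 lam_sqr mulrDl mul1r; lra.
have -> : S = 0.
  by rewrite /S big1 // => i; have := ltn_ord i; rewrite /lev; lia.
by rewrite subr0 /= exprS ltr_pMl // exprn_gt0.
Qed.

Lemma weight_lam_gt0 w : 0 < weight l w.
Proof. by apply: lt_trans (weight_lam_gt w); rewrite exprn_gt0 // lam_gt0. Qed.

(* The powers of [lambar] alternate in sign, with the even ones summing to
   [lam] and the odd ones to [-1]. *)
Lemma sum_lambar_bounds (al : nat -> bool) j :
  - (1 - b ^+ (j.*2)) <= \sum_(i < j.*2) (al i)%:R * b ^+ i <= l * (1 - b ^+ (j.*2)).
Proof.
elim: j => [|j]; first by rewrite big_ord0 expr0 subrr oppr0 mulr0 lexx.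
rewrite doubleS !big_ord_recr /= -[j.*2.+2]addn2 exprD lambar_sqr [b ^+ j.*2.+1]exprS.
move: (\sum_(i < j.*2) _) => S.
have : 0 <= b ^+ j.*2 by rewrite -mul2n exprM; apply: exprn_ge0; exact: sqr_ge0.
move: (b ^+ j.*2) => B B0 /andP[h1 h2].
have lbE := lambarE; have l1 := lam_gt1; have l2 := lam_lt2; have lE := lam_sqr.
rewrite lbE; rewrite expr2 in lE.
have llB : l * (l * B) = l * B + B by rewrite mulrA lE mulrDl mul1r.
have lB : B <= l * B by rewrite ler_peMl // ltW.
have lB2 : l * B <= 2%:R * B by rewrite ler_wpM2r // ltW.
by case: (al j.*2); case: (al j.*2.+1); rewrite ?mul1r ?mul0r; apply/andP; split; lra.
Qed.

Lemma weight_lambar_bounds w : - l < weight b w < 1.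
Proof.
pose al i := i \in supp w.
(* Padding the exponents with zeros to an even length 2j makes [sum_lambar_bounds] applicable. As 2j
   is below the level n, the term lambar^n is smaller in absolute value than lambar^(2j), and this
   makes both bounds strict. *)
have [j [jl jw]] : exists j, (j.*2 < lev w)%N /\ (lev w - 3 <= j.*2)%N.
  exists (lev w - 2)./2; have := odd_double_half (lev w - 2); rewrite /lev.
  by case: odd; lia.
have SE : \sum_(i < lev w - 3) (tagged w i)%:R * b ^+ i = \sum_(i < j.*2) (al i)%:R * b ^+ i.
  rewrite -(big_mkord xpredT (fun i => (al i)%:R * b ^+ i)) [RHS](big_cat_nat (leq0n _) jw) /=.
  rewrite [X in _ + X]big_nat_cond [X in _ + X]big1 ?addr0 => [|i].
    rewrite big_mkord; apply: eq_bigr => i _; congr (_%:R * _).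
    rewrite /al /supp inE /= mem_map; last exact: val_inj.
    by rewrite mem_filter mem_enum andbT.
  rewrite andbT => /andP[wi _]; rewrite /al.
  have /negbTE -> : i \notin supp w by apply/negP => /supp_lt; lia.
  by rewrite mul0r.
rewrite /weight SE; have /andP[h1 h2] := sum_lambar_bounds al j.
move: (\sum_(i < j.*2) _) h1 h2 => S.
have B0 : 0 < b ^+ j.*2.
  rewrite -mul2n exprM; apply: exprn_gt0; rewrite exprn_even_gt0 //=.
  by rewrite lambarE; have := lam_gt1; lra.
have l1 := lam_gt1; have l2 := lam_lt2.
have : `|b ^+ lev w| < b ^+ j.*2.
  rewrite -(subnKC jl) addSn -addnS exprD normrM (gtr0_norm B0) gtr_pMr // normrX.
  rewrite exprn_ilt1 ?normr_ge0 // lambarE ltr_norml; lra.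
rewrite ltr_norml => /andP[n1 n2] h1 h2; apply/andP; split; last by lra.
have : b ^+ j.*2 <= l * b ^+ j.*2 by rewrite ler_peMl // ltW.
by lra.
Qed.

Section Sums.
Variables (n : nat) (w : 'I_n -> stdmon).
Hypothesis n_gt0 : (0 < n)%N.

Lemma sum_weight_lambar_bounds :
  - l * n%:R < \sum_i weight b (w i) /\ \sum_i weight b (w i) < n%:R.
Proof.
have has0 : has (fun=> true) (index_enum 'I_n).
  by apply/hasP; exists (Ordinal n_gt0) => //; rewrite mem_index_enum.
split.
  have -> : - l * n%:R = \sum_(i < n) - l by rewrite sumr_const card_ord mulr_natr.
  by apply: ltr_sum => // i _; case/andP: (weight_lambar_bounds (w i)).
have -> : n%:R = \sum_(i < n) (1 : RR) by rewrite sumr_const card_ord.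
by apply: ltr_sum => // i _; case/andP: (weight_lambar_bounds (w i)).
Qed.

Lemma sum_weight_lam_bounds m : (0 < m)%N -> reaches_level m w ->
  l ^+ m.-1 < \sum_i weight l (w i) /\ \sum_i weight l (w i) <= n%:R * l ^+ m.
Proof.
move=> m0 [wm [i wi]]; split.
  rewrite (bigD1 i) //= -wi; apply: lt_le_trans (weight_lam_gt _) _.
  by rewrite lerDl; apply: sumr_ge0 => j _; exact/ltW/weight_lam_gt0.
have -> : n%:R * l ^+ m = \sum_(i < n) l ^+ m.
  by rewrite sumr_const card_ord mulr_natl.
apply: ler_sum => j _; apply: le_trans (weight_lam_le _) _.
by rewrite ler_eXn2l ?wm // lam_gt1.
Qed.

(** As lambda lambar = -1, multiplication by lambda^2 turns the superweight into y - lambda x, and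
    the strip for swt into the one for (x, y). *)
Lemma ev_lambarE (g : int * int) : l ^+ 2 * ev b g = g.2%:~R - l * g.1%:~R.
Proof.
have -> : l ^+ 2 * ev b g = (l * b) ^+ 2 * g.2%:~R + l * (l * b) * g.1%:~R.
  by rewrite /ev; ring.
by rewrite lamM_lambar; ring.
Qed.

Lemma strip_bounds (g : int * int) : - l * n%:R < ev b g -> ev b g < n%:R ->
  - l ^+ 3 * n%:R + l * g.1%:~R < g.2%:~R /\
  g.2%:~R < l * g.1%:~R + l ^+ 2 * n%:R.
Proof.
have l2 : 0 < l ^+ 2 by rewrite exprn_gt0 // lam_gt0.
rewrite -(ltr_pM2l l2) ev_lambarE mulrA => h1.
rewrite -(ltr_pM2l l2) ev_lambarE => h2.
have l3 : l ^+ 2 * - l = - l ^+ 3 by ring.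
by split; [rewrite l3 in h1|]; lra.
Qed.

End Sums.
End Numerics.

(** * Chains and homology of the Fibonacci Lie algebra *)

Section FibHomology.
Variable K : fieldType.
Hypothesis char2 : 2%N \in [pchar K].
Local Notation R := (trunc K).
Local Notation sd := (stdmon_der K).
Local Notation e := (stdmon_fib K).
Local Notation br := (@fib_br K).

Lemma val_fib_set (x : fib K) : fib_set (val x).
Proof. exact: (fibP _ (valP x)). Qed.

Lemma fib_valD a (x y : fib K) : val (a *: x + y) = a *: val x + val y.
Proof. by []. Qed.

Lemma fib_val_linear (x : fib K) : linear (val x).
Proof.
apply: (lspan_fun_linear _ (fib_set_lspan char2 (val_fib_set x))).
by move=> _ [w _ <-]; exact: stdmon_der_linear.
Qed.

Lemma fib_br_l y : linear (br^~ y).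
Proof.
move=> a u v; apply: val_inj.
exact: (commutator_linear_l (fib_val_linear y) a (val u) (val v)).
Qed.

Lemma fib_br_r x : linear (br x).
Proof.
move=> a u v; apply: val_inj.
exact: (commutator_linear_r (fib_val_linear x) a (val u) (val v)).
Qed.

Lemma fib_brxx x : br x x = 0.
Proof. by apply: val_inj; apply/funext => f; rewrite /= /commutator subrr. Qed.

Definition fcoord (x : fib K) := der_coord (val x).

Lemma fcoord_linear : linear fcoord.
Proof.
move=> a x y; apply: of_coord_inj; rewrite of_coord_linear /fcoord.
by rewrite !(der_coordK char2 (val_fib_set _)).
Qed.

Lemma fcoord_e w : fcoord (e w) = << 1 *g w >>.
Proof. by rewrite /fcoord val_stdmon_fib // -of_coordU of_coordK. Qed.

Lemma val_fglift x : val (fglift e x) = of_coord x.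
Proof.
elim/freeg_lin_ind: x => [|a x y Hx Hy|w].
- by rewrite /of_coord !raddf0.
- by rewrite linearP fib_valD Hx Hy of_coord_linear.
- by rewrite liftU scale1r of_coordU val_stdmon_fib.
Qed.

Lemma fcoordK x : fglift e (fcoord x) = x.
Proof. by apply: val_inj; rewrite val_fglift der_coordK //; exact: val_fib_set. Qed.

Lemma fib_br_gr w w' :
  lspan [set e v | v in [set v | gr v = gr w + gr w']] (br (e w) (e w')).
Proof.
have := @wspan_commutator K char2 w w'; rewrite -!(val_stdmon_fib char2).
move=> /lspan_of_coord [x xE Hx].
have -> : br (e w) (e w') = fglift e x by apply: val_inj; rewrite val_fglift xE.
apply: (@lspan_linear _ _ _ (fglift e) _ _ _ _ (lspan_subspace _) _ Hx).
  exact: linearP.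
by move=> _ [v vg <-]; rewrite liftU scale1r; apply: lspan_gen; exists v.
Qed.

Lemma fib_br_homog (G : nmodType) (th : int * int -> G) : {morph th : x y / x + y} ->
  forall w w', lspan [set e v | v in [set v | th (gr v) = th (gr w) + th (gr w')]]
    (br (e w) (e w')).
Proof.
move=> thD w w'; apply: lspan_mono (@fib_br_gr w w') => _ [v vg <-].
by exists v => //=; rewrite vg thD.
Qed.

Lemma Gr_eq : Gr K = gr.
Proof. by apply/funext => w; exact: Gr_gr. Qed.

Section Wt.
Variable RR : realType.
Local Notation l := (lam RR).
Local Notation b := (lambar RR).

Lemma Wt_eq : Wt RR = (fun w => (ev l (gr w), ev b (gr w))).
Proof. by apply/funext => w; exact: Wt_ev. Qed.

Lemma fib_br_Wt w w' :
  lspan [set e v | v in [set v | Wt RR v = Wt RR w + Wt RR w']] (br (e w) (e w')).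
Proof.
rewrite Wt_eq; apply: (@fib_br_homog _ (fun g => (ev l g, ev b g))) => x y.
by rewrite !evD.
Qed.

End Wt.

Lemma fib_br_Gr w w' :
  lspan [set e v | v in [set v | Gr K v = Gr K w + Gr K w']] (br (e w) (e w')).
Proof. by rewrite Gr_eq; exact: fib_br_gr. Qed.

End FibHomology.

(** * Counting standard monomials, dimensions and limits *)

Definition levels (m : nat) : seq stdmon :=
  [seq (existT _ k al : stdmon) | k <- iota 0 m, al <- enum {ffun 'I_(k.+1 - 3) -> bool}].

Lemma mem_levels m w : (lev w <= m)%N -> w \in levels m.
Proof.
case: w => k al km; apply/allpairsPdep; exists k, al.
by rewrite mem_iota mem_enum.
Qed.

Lemma size_levels m : (size (levels m) <= 2 ^ m)%N.
Proof.
rewrite size_allpairs_dep.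
have -> : [seq size (enum {ffun 'I_(k.+1 - 3) -> bool}) | k <- iota 0 m] =
    [seq 2 ^ (k.+1 - 3) | k <- iota 0 m]%N.
  by apply: eq_map => k; rewrite -cardE card_ffun card_bool card_ord.
suff : (sumn [seq 2 ^ (k.+1 - 3) | k <- iota 0 m] < 2 ^ m)%N by exact: ltnW.
elim: m => [|m IH] //; rewrite -[X in iota _ X]addn1 iotaD map_cat sumn_cat /= addn0 add0n.
rewrite expnS mul2n -addnn -addSn; apply: leq_add => //.
by rewrite leq_exp2l //; lia.
Qed.

Section Kdim.
Variables (RR : realType) (K : fieldType) (V : lmodType K).
Implicit Types A : set V.

Lemma kdim_ge0 A : (0 <= kdim RR A)%E.
Proof.
apply: ereal_sup_ubound; exists 0%N => //=.
by exists (fun=> 0); split=> [[]//|c _ []].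
Qed.

Lemma kdim_ge1 A x : A x -> x <> 0 -> (1 <= kdim RR A)%E.
Proof.
move=> Ax x0; apply: ereal_sup_ubound; exists 1%N => //=.
exists (fun=> x); split=> // c; rewrite big_ord1 => cx i; rewrite ord1.
apply/eqP; apply: contra_notT x0 => c0.
by rewrite -[x]scale1r -(mulVf c0) -scalerA cx scaler0.
Qed.

Lemma lspan_family (I : finType) (P : pred I) (y : I -> V) x :
  lspan [set y i | i in [set i | P i]] x ->
  exists c : I -> K, x = \sum_(i | P i) c i *: y i.
Proof.
apply: (@lspan_min _ _ _ [set x | exists c : I -> K, x = \sum_(i | P i) c i *: y i]).
  split=> [|a _ _ [c ->] [d ->]].
    by exists (fun=> 0); rewrite big1 // => i _; rewrite scale0r.
  exists (fun i => a * c i + d i); rewrite scaler_sumr -big_split.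
  by apply: eq_bigr => i _; rewrite scalerDl scalerA.
move=> _ [i Pi <-]; exists (fun j => (j == i)%:R).
rewrite (bigD1 i) //= eqxx scale1r big1 ?addr0 // => j /andP[_ /negbTE ->].
by rewrite scale0r.
Qed.

(** More than #|P| vectors in the span give a coefficient matrix with more rows than columns; a
    nonzero vector of its left kernel is a linear relation between them. *)
Lemma kdim_le (I : finType) (P : pred I) (y : I -> V) A :
  A `<=` lspan [set y i | i in [set i | P i]] ->
  (kdim RR A <= (#|P|%:R)%:E)%E.
Proof.
move=> AP; apply: ge_ereal_sup => _ [k [x [Ax xi]] <-].
rewrite lee_fin ler_nat leqNgt; apply/negP => Pk.
have h i := lspan_family (AP _ (Ax i)).
pose c i := projT1 (cid (h i)).
have cE i : x i = \sum_(j | P j) c i j *: y j by rewrite /c; case: cid.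
pose M : 'M[K]_(k, #|P|) := \matrix_(i, j) c i (enum_val j).
have : kermx M != 0.
  by rewrite -mxrank_eq0 mxrank_ker subn_eq0 -ltnNge (leq_ltn_trans (rank_leq_col M)).
case/rowV0Pn => v /sub_kermxP vM; apply/negP; rewrite negbK.
apply/eqP/rowP => i; rewrite [RHS]mxE; apply: (xi (fun i => v 0 i)) => {i}.
under eq_bigr do rewrite cE scaler_sumr.
rewrite exchange_big /= big1 // => j Pj.
under eq_bigr do rewrite scalerA.
rewrite -scaler_suml.
have /rowP/(_ (enum_rank_in Pj j)) := vM; rewrite !mxE => vMj.
rewrite (_ : \sum_(i < k) v 0 i * c i j = 0) ?scale0r // -[RHS]vMj.
by apply: eq_bigr => i _; rewrite mxE enum_rankK_in.
Qed.

End Kdim.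

Lemma limn_esup_le (RR : realType) (u : (\bar RR)^nat) (c : RR) :
  (forall eps, 0 < eps -> exists N, forall k, (N <= k)%N -> (u k <= (c + eps)%:E)%E) ->
  (limn_esup u <= c%:E)%E.
Proof.
move=> h; apply/lee_addgt0Pr => eps eps0; have [N hN] := h eps eps0.
apply: le_trans (_ : ereal_sup (u @` [set k | (N <= k)%N]) <= _)%E.
  apply: ereal_inf_lbound; exists [set k | (N <= k)%N] => //.
  exact: nbhs_infty_ge.
by apply: ge_ereal_sup => _ [k Nk <-]; exact: hN.
Qed.

Lemma nneseries_infinitely_many (RR : realType) (u : (\bar RR)^nat) (m : nat) :
  (forall k, (0 <= u k)%E) ->
  (forall N, exists2 k, (N <= k)%N & (1 <= u k)%E) ->
  (\sum_(m <= k <oo) u k = +oo)%E.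
Proof.
move=> u0 u1; apply/eqyP => A A0.
have [M AM] : exists M : nat, A <= M%:R by exists (Num.Def.truncn A).+1; apply/ltW/truncnS_gt.
apply: le_trans (_ : M%:R%:E <= _)%E; first by rewrite lee_fin.
suff [k hk] : exists k, (m <= k)%N /\ (M%:R%:E <= \sum_(m <= i < k) u i)%E.
  apply: le_trans (proj2 hk) _; apply: nneseries_lim_ge => *; exact: u0.
elim: M {AM} => [|M [k [mk hk]]]; first by exists m; rewrite big_geq.
have [k' kk' uk'] := u1 k; exists k'.+1; split; first by lia.
rewrite big_nat_recr /=; last by lia.
rewrite -natr1 EFinD; apply: leeD => //; apply: le_trans hk _.
rewrite (big_cat_nat mk kk') /=; apply: leeDl; apply: sume_ge0 => *; exact: u0.
Qed.

(** * Infinite total dimension of homology *)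

Section FibInfinite.
Variables (K : fieldType) (RR : realType).
Hypothesis char2 : 2%N \in [pchar K].
Local Notation l := (lam RR).
Local Notation b := (lambar RR).

Lemma expr_lambar_gt0 N : 0 < b ^+ (N.*2).
Proof.
rewrite -mul2n exprM; apply: exprn_gt0; rewrite exprn_even_gt0 //= lambarE.
by have := lam_gt1 RR; lra.
Qed.

Lemma weight_mk0 x k : x ^+ 2 = x + 1 -> weight x (mkstd k fset0) = x ^+ k.+1 :> RR.
Proof. by move=> xE; rewrite weight_ev // gr_mk0 ev_grv. Qed.

(* After cancelling the common elements, phi is negative on what remains of B and
   nonnegative on what remains of A. *)
Lemma uniq_sum_weights (A B : seq stdmon) (phi : stdmon -> RR) : uniq A -> uniq B ->
  (forall v, (v \in A) = (0 <= phi v)) ->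
  \sum_(v <- A) phi v = \sum_(v <- B) phi v ->
  \sum_(v <- A) weight l v = \sum_(v <- B) weight l v -> size A = size B.
Proof.
move=> uA uB Aphi.
have E (F : stdmon -> RR) : \sum_(v <- A) F v = \sum_(v <- B) F v ->
    \sum_(v <- A | v \notin B) F v = \sum_(v <- B | v \notin A) F v.
  rewrite (bigID (mem B)) [X in _ = X](bigID (mem A)) /=.
  rewrite (_ : \sum_(v <- A | v \in B) F v = \sum_(v <- B | v \in A) F v); first by move/addrI.
  rewrite -big_filter -[RHS]big_filter; apply: perm_big.
  by apply: uniq_perm; rewrite ?filter_uniq // => v; rewrite !mem_filter andbC.
move=> /E Ephi /E Ewt.
have BA : {subset B <= A}.
  move=> v vB; rewrite -[_ \in _]negbK; apply/negP => vA.
  have : 0 <= \sum_(v <- A | v \notin B) phi v.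
    by rewrite big_seq_cond; apply: sumr_ge0 => u /andP[]; rewrite Aphi.
  rewrite Ephi leNgt => /negP; apply.
  rewrite -big_filter (bigD1_seq v) ?filter_uniq ?mem_filter ?vA //= -[ltRHS]addr0.
  apply: ltr_leD; first by rewrite ltNge -Aphi.
  rewrite big_seq_cond; apply: sumr_le0 => u /andP[]; rewrite mem_filter => /andP[uA' _] _.
  by apply: ltW; rewrite ltNge -Aphi.
(* Elements of A with phi = 0 are not seen by phi; positivity of the weight excludes that B misses
   one of them. *)
have AB : {subset A <= B}.
  move=> v vA; rewrite -[_ \in _]negbK; apply/negP => vB.
  have : 0 < \sum_(v <- A | v \notin B) weight l v.
    rewrite -big_filter (bigD1_seq v) ?filter_uniq ?mem_filter ?vB //=.
    apply: ltr_pwDl; first exact: weight_lam_gt0.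
    by apply: sumr_ge0 => u _; apply/ltW/weight_lam_gt0.
  rewrite Ewt big_seq_cond big1 ?ltxx // => u /andP[/BA ->] //.
by apply: perm_size; apply: uniq_perm => // v; apply/idP/idP => [/AB|/BA].
Qed.

Lemma homology_neq0_large N : exists2 n, (N <= n)%N &
  exists2 h, homology (@fib_br K) n h & h <> 0.
Proof.
(* With N > 0 the set A is nonempty, so that [(size A).-1] differs from [size A] at the end. *)
wlog N0 : N / (0 < N)%N.
  by move=> H; have [n Nn Hn] := H N.+1 isT; exists n => //; exact: ltnW.
pose eps := b ^+ N.*2.*2.
have eps0 : 0 < eps := expr_lambar_gt0 _.
have l0 := lam_gt0 RR; have l1 := lam_gt1 RR.
have leps : l ^+ N.*2.*2 * eps = 1.
  by rewrite /eps -exprMn lamM_lambar -signr_odd odd_double expr0.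
pose phi v := weight b v - eps * weight l v.
pose A := [seq v <- undup (levels N.*2.*2) | 0 <= phi v].
have uA : uniq A by rewrite filter_uniq // undup_uniq.
(* Filtering the levels up to 4N loses nothing: phi v >= 0 and swt v < 1 give wt v < 1 / eps =
   lambda^(4N), which bounds the level. *)
have Aphi v : (v \in A) = (0 <= phi v).
  rewrite mem_filter mem_undup; have [p0|//] := boolP (0 <= phi v).
  rewrite mem_levels //.
  have [_ b1] := andP (weight_lambar_bounds RR v).
  have : l ^+ (lev v).-1 < l ^+ N.*2.*2.
    apply: lt_trans (weight_lam_gt _ v) _.
    rewrite -(ltr_pM2l eps0) [X in _ < X]mulrC leps.
    by apply: le_lt_trans b1; rewrite -subr_ge0.
  by rewrite ltr_eXn2l // /lev.
have sA : (N <= size A)%N.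
  pose s := [seq mkstd j.*2.+1 fset0 | j <- iota 0 N].
  have -> : N = size s by rewrite size_map size_iota.
  apply: uniq_leq_size.
    rewrite map_inj_uniq ?iota_uniq // => i j /(congr1 tag) /= [].
    exact: double_inj.
  move=> _ /mapP[j + ->]; rewrite mem_iota add0n => /andP[_ jN].
  rewrite Aphi /phi !weight_mk0 ?lambar_sqr ?lam_sqr //.
  rewrite /eps -[j.*2.+2]/(j.+1).*2.
  have -> : (N.*2.*2 = (N.*2 - j.+1).*2 + (j.+1).*2)%N by lia.
  rewrite exprD -mulrA -exprMn [b * l]mulrC lamM_lambar -signr_odd odd_double expr0 mulr1.
  have -> : ((N.*2 - j.+1).*2 = (j.+1).*2 + ((N.*2 - j.+1).*2 - (j.+1).*2))%N by lia.
  rewrite exprD subr_ge0 ger_pMr ?expr_lambar_gt0 //.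
  have -> : ((N.*2 - j.+1).*2 - (j.+1).*2 = (N.*2 - (j.+1).*2).*2)%N by lia.
  rewrite -mul2n exprM lambar_sqr exprn_ile1 // lambarE.
    by have := lam_lt2 RR; lra.
  by lra.
exists (size A) => //.
pose w i := tnth (in_tuple A) i.
have iw : injective w by apply/tuple_uniqP.
(* Equality of the pairs (wt, swt) yields equal sums of phi and of wt, the two hypotheses of
   [uniq_sum_weights]. *)
have noB m (v : 'I_m -> stdmon) : injective v ->
    \sum_i Wt RR (v i) = \sum_i Wt RR (w i) -> m = size A.
  move=> iv.
  have sumB (F : stdmon -> RR) : \sum_i F (v i) = \sum_(x <- [seq v i | i <- enum 'I_m]) F x.
    by rewrite big_map big_enum.
  have sumA (F : stdmon -> RR) : \sum_i F (w i) = \sum_(x <- A) F x.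
    by rewrite [RHS]big_tnth.
  have fst_sum (I : finType) (u : I -> stdmon) : (\sum_i Wt RR (u i)).1 = \sum_i weight l (u i).
    by rewrite (big_morph fst (id1 := 0) (op1 := +%R)).
  have snd_sum (I : finType) (u : I -> stdmon) : (\sum_i Wt RR (u i)).2 = \sum_i weight b (u i).
    by rewrite (big_morph snd (id1 := 0) (op1 := +%R)).
  move=> vw; have := congr1 fst vw; have := congr1 snd vw.
  rewrite !fst_sum !snd_sum !sumB !sumA => hb hl.
  have -> : m = size [seq v i | i <- enum 'I_m] by rewrite size_map size_enum_ord.
  apply/esym/(@uniq_sum_weights _ _ phi) => //.
  - by rewrite map_inj_uniq ?enum_uniq.
  - have sp s : \sum_(u <- s) phi u =
        \sum_(u <- s) weight b u - eps * \sum_(u <- s) weight l u.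
      by rewrite /phi sumrB mulr_sumr.
    by rewrite !sp hb hl.
apply: (homology_neq0 (@fcoord_linear K char2) (@fcoord_e K char2)
  (@fcoordK K char2) char2 (@fib_br_l K char2) (@fib_br_r K char2) (@fib_brxx K)
  (@fib_br_Wt K char2 RR) iw (erefl _)).
- by move=> v iv /(noB _ _ iv); lia.
- by move=> v iv /(noB _ _ iv); lia.
Qed.

Lemma sum_kdim_homology :
  (\sum_(2 <= k <oo) kdim RR (homology (@fib_br K) k) = +oo)%E.
Proof.
apply: nneseries_infinitely_many => [k|N]; first exact: kdim_ge0.
have [n Nn [h hn h0]] := homology_neq0_large N.
by exists n => //; exact: kdim_ge1 h0.
Qed.

End FibInfinite.

(** * Growth of homology *)

Section Growth.
Variables (K : fieldType) (RR : realType).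
Hypothesis char2 : 2%N \in [pchar K].
Local Notation l := (lam RR).
Local Notation HC n := (hom_comp (@fib_br K) (stdmon_fib K) (Gr K) n).

Lemma gr_ge0 w : (0 <= (gr w).1)%R /\ (0 <= (gr w).2)%R.
Proof. by have [a [b [-> _]]] := commutator_of_stdmon char2 w. Qed.

Definition total (g : int * int) : int := g.1 + g.2.

Lemma total_gr_ge0 w : 0 <= total (gr w).
Proof. by have [h1 h2] := gr_ge0 w; rewrite addr_ge0. Qed.

Lemma total_sum (I : finType) (F : I -> int * int) :
  total (\sum_i F i) = \sum_i total (F i).
Proof.
by apply: (big_morph total) => // x y; rewrite /total addrACA.
Qed.

Lemma total_gr_le n (w : 'I_n -> stdmon) i : total (gr (w i)) <= total (\sum_i gr (w i)).
Proof.
rewrite total_sum (bigD1 i) //= lerDl; apply: sumr_ge0 => j _.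
exact: total_gr_ge0.
Qed.

(** The component of degree g is spanned by the classes of n-tuples of degree g. Since total degrees
    of monomials are nonnegative, each entry has total degree at most k, hence level at most m, and
    there are at most (2^m)^n such tuples. *)
Lemma esum_kdim_le n k m : (forall w, total (gr w) <= k%:Z -> (lev w <= m)%N) ->
  (\esum_(g in [set g : int * int | (g.1 + g.2 <= k%:Z)%R]) kdim RR (HC n g) <=
   (((2 ^ m) ^ n)%:R)%:E)%E.
Proof.
move=> hm; pose w0 : stdmon := mkstd 0 fset0.
pose I := {ffun 'I_n -> 'I_(size (levels m))}.
pose v (phi : I) (i : 'I_n) : stdmon := nth w0 (levels m) (phi i).
pose deg (phi : I) : int * int := \sum_i gr (v phi i).
have HCle g : (g.1 + g.2 <= k%:Z)%R ->
    (kdim RR (HC n g) <= (#|[pred phi | deg phi == g]|%:R)%:E)%E.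
  move=> gk; apply: (@kdim_le _ _ _ _ _
    (fun phi : I => hclass (@fib_br K) (wedge_of (stdmon_fib K) (v phi)))).
  rewrite Gr_eq // => h /hom_comp_lspan; apply: lspan_mono.
  move=> _ [w [iw wg] <-].
  have wm i : w i \in levels m.
    by apply/mem_levels/hm/(le_trans (total_gr_le w i)); rewrite wg.
  exists [ffun i => Ordinal (n:=size (levels m)) (m:=index (w i) (levels m))
                     (etrans (index_mem _ _) (wm i))].
    rewrite /= /deg -wg; apply/eqP/eq_bigr => i _.
    by rewrite /v ffunE /= nth_index.
  congr hclass; congr (wedge_of (stdmon_fib K)); apply/funext => i.
  by rewrite /v ffunE /= nth_index.
apply: ge_ereal_sup => _ [F [finF Fk] <-]; rewrite fsbig_finite //=.
apply: le_trans (_ : (\sum_(g <- fset_set F) (#|[pred phi | deg phi == g]|%:R)%:E <= _)%E).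
  rewrite big_seq [leRHS]big_seq; apply: lee_sum => g.
  by rewrite in_fset_set // inE => /Fk; exact: HCle.
rewrite sumEFin lee_fin -natr_sum ler_nat.
apply: (@leq_trans #|I|); last first.
  have expn_le a c p : (a <= c)%N -> (a ^ p <= c ^ p)%N.
    by move=> ac; elim: p => // p IH; rewrite !expnS leq_mul.
  by rewrite card_ffun !card_ord expn_le // size_levels.
(* Double counting: each tuple has one degree and is counted for at most one g in F. *)
under eq_bigr do rewrite -sum1_card big_mkcond /=.
rewrite exchange_big /= -sum1_card; apply: leq_sum => phi _.
have [degF|degF] := boolP (deg phi \in fset_set F).
  rewrite (bigD1_seq (deg phi)) ?fset_uniq //= inE eqxx big1 // => g.
  by rewrite inE eq_sym => /negbTE ->.
by rewrite big_seq big1 // => g gF; rewrite inE; case: eqP => // dg; rewrite dg gF in degF.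
Qed.

(** With t the integer part of log_lambda k and multidegree (a, b), lambda^(lev w - 1) < wt w = a
    lambda + b lambda^2 <= lambda^2 k < lambda^(t+3). *)
Lemma lev_le k w : (0 < k)%N -> total (gr w) <= k%:Z ->
  (lev w <= (Num.trunc (ln (k%:R : RR) / ln l)).+3)%N.
Proof.
move=> k0 wk; have l1 := lam_gt1 RR; have l0 := lam_gt0 RR.
have lnl : 0 < ln l by rewrite ln_gt0.
have k1 : (1 : RR) <= k%:R by rewrite ler1n.
have q0 : 0 <= ln (k%:R : RR) / ln l by rewrite divr_ge0 ?ln_ge0 // ltW.
have /andP[_ tk] := Num.Theory.truncn_itv q0.
set t := Num.trunc _ in tk *.
rewrite leqNgt; apply/negP => tw.
have klt : (k%:R : RR) < l ^+ t.+1.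
  have kp : (0 : RR) < k%:R by rewrite ltr0n.
  have lp : 0 < l ^+ t.+1 by rewrite exprn_gt0.
  rewrite -(ltr_ln kp lp) lnXn // -[ln l *+ _]mulr_natl.
  by rewrite -ltr_pdivrMr.
have wl := weight_lam_gt RR w.
have : weight l w <= l ^+ 2 * k%:R.
  rewrite weight_ev ?lam_sqr // /ev.
  have [a0 b0] := gr_ge0 w.
  have : ((gr w).1 + (gr w).2)%:~R <= (k%:R : RR) by rewrite -[k%:R]/((k%:Z)%:~R) ler_int.
  have a0' : 0 <= (gr w).1%:~R :> RR by rewrite ler0z.
  rewrite rmorphD /= lam_sqr.
  move: {klt wl k1 q0 t tk tw} ((gr w).1%:~R : RR) ((gr w).2%:~R : RR) (k%:R : RR) a0' => x y z x0 h.
  have h1 : l * (x + y) <= l * z by rewrite ler_pM2l.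
  by lra.
rewrite leNgt => /negP; apply; apply: le_lt_trans wl.
have : l ^+ t.+3 <= l ^+ (lev w).-1 by rewrite ler_eXn2l //; lia.
apply: le_trans; rewrite -[t.+3]add2n exprD ler_pM2l ?exprn_gt0 //.
exact: ltW.
Qed.

Lemma GKdim_homology_le n : (GKdim_homology RR K n <= (n%:R * (ln 2%:R / ln l))%:E)%E.
Proof.
have l1 := lam_gt1 RR; have lnl : 0 < ln l by rewrite ln_gt0.
have ln2 : 0 < ln (2%:R : RR) by rewrite ln_gt0 // ltr1n.
apply: limn_esup_le => eps eps0.
(* The three extra levels in [lev_le] cost the constant C in the logarithm of the count; it is at
   most eps ln k once k >= exp(C / eps). *)
pose C : RR := 3%:R * n%:R * ln 2%:R.
have C0 : 0 <= C by rewrite !mulr_ge0 ?ler0n // ltW.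
exists (Num.trunc (expR (C / eps))).+2 => k Nk.
have k0 : (0 < k)%N by lia.
have k1 : (1 : RR) < k%:R by rewrite ltr1n; lia.
have lnk : 0 < ln (k%:R : RR) by rewrite ln_gt0.
have Ck : C <= eps * ln k%:R.
  rewrite mulrC -ler_pdivrMr // -[C / eps]expRK ler_ln ?posrE ?expR_gt0 //; last first.
    exact: lt_trans ltr01 k1.
  have /andP[_ tk] := Num.Theory.truncn_itv (expR_ge0 (C / eps)).
  by apply: ltW (lt_le_trans tk _); rewrite ler_nat; lia.
set q := ln (k%:R : RR) / ln l.
have q0 : 0 <= q by rewrite divr_ge0 // ltW.
pose m := (Num.trunc q).+3.
have mq : m%:R <= q + 3%:R.
  have /andP[tk _] := Num.Theory.truncn_itv q0.
  by rewrite /m -addn3 natrD lerD2r.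
have := @esum_kdim_le n k m (fun w => @lev_le k w k0).
set S := \esum_(g in _) _ => Sm.
have S0 : (0 <= S)%E by apply: esum_ge0 => g _; exact: kdim_ge0.
apply: (@le_trans _ _ ((n%:R * m%:R * ln 2%:R)%:E * ((ln k%:R)^-1)%R%:E)%E).
  apply: lee_wpmul2r; first by rewrite lee_fin invr_ge0 ltW.
  have -> : (n%:R * m%:R * ln 2%:R)%:E = lne (((2 ^ m) ^ n)%:R%:E : \bar RR).
    rewrite lne_EFin ?ltr0n ?expn_gt0 // -expnM natrX lnXn ?ltr0n //.
    by congr (_%:E); rewrite -[RHS]mulr_natl natrM [m%:R * _]mulrC.
  by rewrite lee_lne // in_itv /= ?leey ?andbT // lee_fin ler0n.
rewrite -EFinM lee_fin ler_pdivrMr // mulrDl.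
have -> : n%:R * (ln 2%:R / ln l) * ln k%:R = n%:R * q * ln 2%:R by rewrite /q; ring.
apply: le_trans (_ : n%:R * (q + 3%:R) * ln 2%:R <= _).
  by rewrite ler_pM2r // ler_wpM2l ?ler0n.
have -> : n%:R * (q + 3%:R) * ln 2%:R = n%:R * q * ln 2%:R + C by rewrite /C; ring.
by rewrite lerD2l.
Qed.

End Growth.

(** * Gradings and strip bounds for the Fibonacci Lie algebra *)

Section FibGraded.
Variables (K : fieldType) (RR : realType).
Hypothesis char2 : 2%N \in [pchar K].
Local Notation e := (stdmon_fib K).
Local Notation br := (@fib_br K).
Local Notation l := (lam RR).
Local Notation b := (lambar RR).

Lemma fib_degree_extends (G : nmodType) (f : stdmon -> G) n :
  (forall w w', lspan [set e v | v in [set v | f v = f w + f w']] (br (e w) (e w'))) ->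
  degree_extends br e f n.
Proof.
move=> h; apply: (degree_extendsP (fcoord_linear char2) (fcoord_e char2)
  (fcoordK char2) char2 (fib_br_l char2) (fib_br_r char2) (@fib_brxx K) h).
Qed.

Lemma fib_graded (G : nmodType) (f : stdmon -> G) n :
  (forall w w', lspan [set e v | v in [set v | f v = f w + f w']] (br (e w) (e w'))) ->
  graded br e f n.
Proof.
move=> h; apply: (gradedP (fcoord_linear char2) (fcoord_e char2)
  (fcoordK char2) char2 (fib_br_l char2) (fib_br_r char2) (@fib_brxx K) h).
Qed.

Lemma sum_Wt n (w : 'I_n -> stdmon) :
  \sum_i Wt RR (w i) = (\sum_i weight l (w i), \sum_i weight b (w i)).
Proof.
rewrite [LHS]surjective_pairing.
by congr pair; [rewrite (big_morph fst (id1 := 0) (op1 := +%R))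
               |rewrite (big_morph snd (id1 := 0) (op1 := +%R))].
Qed.

Lemma sum_Gr_strip n (w : 'I_n -> stdmon) : (0 < n)%N ->
  let g := \sum_i Gr K (w i) in
  - l ^+ 3 * n%:R + l * g.1%:~R < g.2%:~R /\
  g.2%:~R < l * g.1%:~R + l ^+ 2 * n%:R.
Proof.
move=> n0 g; have [h1 h2] := sum_weight_lambar_bounds RR w n0.
have gE : ev b g = \sum_i weight b (w i).
  rewrite /g Gr_eq // ev_sum; apply: eq_bigr => i _.
  by rewrite weight_ev // lambar_sqr.
by apply: strip_bounds; rewrite gE.
Qed.

End FibGraded.

Theorem theorem51 (K : fieldType) (RR : realType) (n : nat)
    (char2 : 2%N \in [pchar K]) (n_gt0 : (0 < n)%N) :
  let br := @fib_br K in
  let e := stdmon_fib K in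
  let l := lam RR in
  (* 1 *)
  (degree_extends br e (Wt RR) n /\ graded br e (Wt RR) n) /\
  (* 2 *)
  degree_extends br e (Gr K) n /\
  (* 3 *)
  graded br e (Gr K) n /\
  (* 4 *)
  ((forall (m : nat) (w : 'I_n -> stdmon), (0 < m)%N -> injective w ->
      reaches_level m w ->
      let wt := (chain_deg e (Wt RR) (wedge_of e w)).1 in
      l ^+ m.-1 < wt /\ wt <= n%:R * l ^+ m) /\
   (forall (m : nat) (z : chain (fib K) n), (0 < m)%N -> cycles br n z ->
      (exists g, chain_comp e (Wt RR) n g z) ->
      lspan [set wedge_of e w | w in
               [set w : 'I_n -> stdmon | injective w /\ reaches_level m w]] z ->
      hclass br z <> 0 ->
      let wt := (hom_deg br e (Wt RR) (hclass br z)).1 in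
      l ^+ m.-1 < wt /\ wt <= n%:R * l ^+ m)) /\
  (* 5 *)
  ((forall w : 'I_n -> stdmon, injective w ->
      let u := wedge_of e w in
      let swt := (chain_deg e (Wt RR) u).2 in
      let x : RR := (chain_deg e (Gr K) u).1%:~R in
      let y : RR := (chain_deg e (Gr K) u).2%:~R in
      (- l * n%:R < swt /\ swt < n%:R) /\
      (- l ^+ 3 * n%:R + l * x < y /\ y < l * x + l ^+ 2 * n%:R)) /\
   (forall h, h <> 0 -> (exists g, hom_comp br e (Wt RR) n g h) ->
      let swt := (hom_deg br e (Wt RR) h).2 in
      - l * n%:R < swt /\ swt < n%:R) /\
   (forall h, h <> 0 -> (exists g, hom_comp br e (Gr K) n g h) ->
      let x : RR := (hom_deg br e (Gr K) h).1%:~R in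
      let y : RR := (hom_deg br e (Gr K) h).2%:~R in
      - l ^+ 3 * n%:R + l * x < y /\ y < l * x + l ^+ 2 * n%:R)) /\
  (* 6 *)
  (GKdim_homology RR K n <= (n%:R * (ln 2%:R / ln l))%:E)%E /\
  (* 7 *)
  (\sum_(2 <= k <oo) kdim RR (homology br k) = +oo)%E.
Proof.
have brW := @fib_br_Wt K char2 RR; have brG := @fib_br_Gr K char2.
move=> br e l.
have dW := fib_degree_extends char2 n brW; have dG := fib_degree_extends char2 n brG.
have [dW1 dW2 _ dW4] := dW; have [dG1 dG2 _ dG4] := dG.
(* The degree of a nonzero homogeneous class is attained by a wedge of standard monomials, so the
   bounds for tuples apply to it. *)
have hW h g : h <> 0 -> hom_comp br e (Wt RR) n g h ->
    exists w : 'I_n -> stdmon, hom_deg br e (Wt RR) h = \sum_i Wt RR (w i).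
  move=> h0 hg.
  have [w [_ wg]] := hom_comp_deg_ex (fcoord_linear char2) (fcoord_e char2) char2 h0 hg.
  by exists w; rewrite wg; case: hg h0 => z [zc zg] <-; exact: dW4.
have hG h g : h <> 0 -> hom_comp br e (Gr K) n g h ->
    exists w : 'I_n -> stdmon, hom_deg br e (Gr K) h = \sum_i Gr K (w i).
  move=> h0 hg.
  have [w [_ wg]] := hom_comp_deg_ex (fcoord_linear char2) (fcoord_e char2) char2 h0 hg.
  by exists w; rewrite wg; case: hg h0 => z [zc zg] <-; exact: dG4.
split; first by split; [exact: dW|exact: fib_graded].
split; first exact: dG.
split; first exact: fib_graded.
split.
  split=> [m w m0 iw wm wt|m z m0 zc [g zg] zm z0 wt].
    rewrite /wt (proj2 (dW1 w iw)) sum_Wt; exact: sum_weight_lam_bounds.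
  have zn0 : z <> 0 by move=> zE; apply: z0; rewrite zE /hclass raddf0.
  have [w [[iw wm] wg]] := lspan_deg_ex (fcoord_linear char2) (fcoord_e char2) char2
    (fun w Tw => proj1 Tw) zm zg zn0.
  rewrite /wt (dW4 g z zc zg z0) -wg sum_Wt; exact: sum_weight_lam_bounds.
split.
  split=> [w iw u swt x y|].
    rewrite /x /y /swt /u (proj2 (dW1 w iw)) (proj2 (dG1 w iw)) sum_Wt.
    by split; [exact: sum_weight_lambar_bounds|exact: sum_Gr_strip].
  split=> h h0 [g hg].
    have [w ->] := hW h g h0 hg; rewrite sum_Wt; exact: sum_weight_lambar_bounds.
  have [w ->] := hG h g h0 hg; exact: sum_Gr_strip.
split; first exact: GKdim_homology_le.
exact: sum_kdim_homology.
Qed.
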